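(* Let $R$ be a P$v$MD. Then: (1) $R$ is a $t\#$-domain if and only if $R\langle X\rangle$ is a $\#$-domain; (2) $R$ is a $t\#\#$-domain if and only if $R\langle X\rangle$ is a $\#\#$-domain; (3) $R$ is a $tRTP$-domain if and only if $R\langle X\rangle$ is an $RTP$-domain.
   Context: $R$ is an integral domain with quotient field $K\neq R$. For nonzero $R$-submodules $A,B$ of $K$, $(A:B)=\{x\in K: xB\subseteq A\}$. For a nonzero fractional ideal $I$, $I_v=(R:(R:I))$, $I_t=\bigcup\{J_v: J\subseteq I\text{ nonzero finitely generated}\}$; $I$ is a $t$-ideal if $I=I_t$; $t$-primes are prime $t$-ideals; $t\text{-Max}(R)$ is the set of ideals maximal among proper $t$-ideals. $R$ is a P$v$MD if $R_M$ is a valuation domain for every $M\in t\text{-Max}(R)$. For $f\in R[X]$, $c(f)$ is the ideal generated by its coefficients; the $t$-Nagata ring is $R\langle X\rangle=R[X]_{N_t}$ with $N_t=\{f\in R[X]: c(f)_t=R\}$. A domain $D$ is a $\#$-domain if $\bigcap_{M\in\mathcal M_1}D_M\neq\bigcap_{M\in\mathcal M_2}D_M$ for any two distinct nonempty sets $\mathcal M_1,\mathcal M_2$ of maximal ideals, and a $\#\#$-domain if every overring is a $\#$-domain. $R$ is a $t\#$-domain if $\bigcap_{M\in\mathcal M_1}R_M\neq\bigcap_{M\in\mathcal M_2}R_M$ for any two distinct subsets of $t\text{-Max}(R)$, and a $t\#\#$-domain if $\bigcap_{P\in\mathcal P_1}R_P\neq\bigcap_{P\in\mathcal P_2}R_P$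 for any two distinct sets $\mathcal P_1,\mathcal P_2$ of pairwise incomparable $t$-primes. $D$ is an $RTP$-domain if for each nonzero ideal $I$, either $I(D:I)=D$ or $I(D:I)$ is a radical ideal; $R$ is a $tRTP$-domain if for each nonzero ideal $I$, either $(I(R:I))_t=R$ or $(I(R:I))_t$ is a radical ideal. *)

(* Defs.v *)
From HB Require Import structures.
From mathcomp Require Import all_boot all_algebra fraction.
From mathcomp Require Import boolp classical_sets.
Set Implicit Arguments. Unset Strict Implicit. Unset Printing Implicit Defensive.
Import GRing.Theory.
Local Open Scope ring_scope.
Local Open Scope classical_set_scope.

(* General framework: D is a (sub)domain of a field F, F being its quotient field.
   Submodules / ideals of D are subsets of F. *)
Section StarOps.
Variables (F : fieldType) (D : set F).

Definition subring (T : set F) : Prop :=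
  [/\ T 0, T 1, (forall x y, T x -> T y -> T (x - y)) &
      (forall x y, T x -> T y -> T (x * y))].

Definition colon (A B : set F) : set F := [set x | forall b, B b -> A (x * b)].

Definition span (s : seq F) : set F :=
  [set x | exists r : seq F, [/\ size r = size s,
     (forall i, (i < size s)%N -> D r`_i) & x = \sum_(i < size s) r`_i * s`_i]].

Definition prodm (I J : set F) : set F :=
  [set x | exists (n : nat) (a b : nat -> F),
     (forall i, (i < n)%N -> I (a i) /\ J (b i)) /\ x = \sum_(i < n) a i * b i].

Definition submodule (I : set F) : Prop :=
  [/\ I 0, (forall x y, I x -> I y -> I (x + y)) &
      (forall r x, D r -> I x -> I (r * x))].

Definition frac_ideal (I : set F) : Prop :=
  [/\ submodule I, I <> [set 0] &
      exists d, [/\ d != 0, D d & forall x, I x -> D (d * x)]].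

Definition ideal (I : set F) : Prop := submodule I /\ I `<=` D.

Definition vclos (I : set F) : set F := colon D (colon D I).

Definition tclos (I : set F) : set F :=
  [set x | exists s : seq F, [/\ span s `<=` I, span s <> [set 0] & vclos (span s) x]].

Definition t_ideal (I : set F) : Prop := frac_ideal I /\ tclos I = I.

Definition prime_ideal (P : set F) : Prop :=
  [/\ ideal P, P <> D &
      forall a b, D a -> D b -> P (a * b) -> P a \/ P b].

Definition t_prime (P : set F) : Prop := prime_ideal P /\ t_ideal P.

Definition t_max (M : set F) : Prop :=
  [/\ ideal M, M <> D, t_ideal M &
      forall N, ideal N -> N <> D -> t_ideal N -> M `<=` N -> N = M].

Definition max_ideal (M : set F) : Prop :=
  [/\ ideal M, M <> D &
      forall N, ideal N -> N <> D -> M `<=` N -> N = M].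

Definition loc (P : set F) : set F :=
  [set x | exists s, [/\ D s, ~ P s & D (s * x)]].

(* intersection of D_P over P in fam (F itself for an empty family) *)
Definition bigloc (fam : set (set F)) : set F :=
  [set x | forall P, fam P -> loc P x].

Definition valuation_dom (T : set F) : Prop :=
  forall x, x != 0 -> T x \/ T x^-1.

Definition PvMD : Prop := forall M, t_max M -> valuation_dom (loc M).

Definition sharp_dom : Prop :=
  forall M1 M2 : set (set F), M1 !=set0 -> M2 !=set0 ->
    M1 `<=` max_ideal -> M2 `<=` max_ideal -> M1 <> M2 ->
    bigloc M1 <> bigloc M2.

Definition t_sharp_dom : Prop :=
  forall M1 M2 : set (set F),
    M1 `<=` t_max -> M2 `<=` t_max -> M1 <> M2 -> bigloc M1 <> bigloc M2.

Definition pairwise_incomparable (fam : set (set F)) : Prop :=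
  forall P Q, fam P -> fam Q -> P `<=` Q -> P = Q.

Definition t_sharp_sharp_dom : Prop :=
  forall P1 P2 : set (set F),
    P1 `<=` t_prime -> P2 `<=` t_prime ->
    pairwise_incomparable P1 -> pairwise_incomparable P2 ->
    P1 <> P2 -> bigloc P1 <> bigloc P2.

Definition radical_ideal (J : set F) : Prop :=
  ideal J /\ forall x n, D x -> J (x ^+ n) -> J x.

Definition RTP_dom : Prop :=
  forall I, ideal I -> I <> [set 0] ->
    prodm I (colon D I) = D \/ radical_ideal (prodm I (colon D I)).

Definition tRTP_dom : Prop :=
  forall I, ideal I -> I <> [set 0] ->
    tclos (prodm I (colon D I)) = D \/ radical_ideal (tclos (prodm I (colon D I))).

End StarOps.

Definition sharp_sharp_dom (F : fieldType) (D : set F) : Prop :=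
  forall T : set F, subring T -> D `<=` T -> sharp_dom T.

Section Nagata.
Variable R : idomainType.

Definition Rimg : set {fraction R} := [set x | exists r : R, x = FracField.tofrac r].

Definition content (g : {poly R}) : set {fraction R} :=
  span Rimg [seq FracField.tofrac c | c <- (g : seq R)].

Definition Nt : set {poly R} := [set g | tclos Rimg (content g) = Rimg].

Definition nagata : set {fraction {poly R}} :=
  [set x | exists f g : {poly R}, Nt g /\
      x = FracField.tofrac f / FracField.tofrac g].

End Nagata.
Arguments Rimg R : clear implicits.
Arguments nagata R : clear implicits.
Arguments Nt R : clear implicits.

(* Main.v *)
(** The contraction [B |-> B :&: K] is a bijection from the [T]-submodules of K(X), where
    [T = R<X>], onto the t-closed [R]-submodules of K; its inverse sends [A] to the set of
    fractions [h / n] with [h] in A[X] and [n] in N_t.  The key point is that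
    [h T = c(h) T] for every nonzero [h] in K[X]: [c(h)] is t-invertible because [R] is a
    PvMD, so some [h'] in K[X] satisfies [h h' \in N_t] and [c(h) h' <= R[X]].  This bijection
    matches maximal ideals with t-maximal ideals, nonzero primes with t-primes, localizations,
    and trace ideals up to t-closure, which gives (1) and (3).  It also shows that [T] is
    Bezout: [f] and [f'] generate the same ideal as [f + X^k f'] for large [k].  For (2) it
    remains to see that a Bezout domain is a ##-domain iff distinct families of pairwise
    incomparable nonzero primes have distinct intersections of localizations: a maximal ideal
    of an overring is determined by its contraction, which has the same localization, and if
    [S] is the intersection of the localizations at an incomparable family, the #-property
    of [S] forces the maximal ideals of [S] to be exactly the centers of that family. *)

From HB Require Import structures.
From mathcomp Require Import all_boot all_algebra fraction.
From mathcomp Require Import boolp classical_sets.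
Require Import Defs.
Set Implicit Arguments. Unset Strict Implicit. Unset Printing Implicit Defensive.
Import GRing.Theory.
Local Open Scope ring_scope.
Local Open Scope classical_set_scope.

(** Zorn's lemma is applied to the sets whose union with [J] satisfies [Q]. Adding [J] as bottom
    element to each chain keeps it nonempty, so the empty chain is covered by [Q J]. *)
Lemma zorn_above (T : Type) (J : set T) (Q : set (set T)) :
  Q J ->
  (forall C, C J -> (forall X, C X -> J `<=` X /\ Q X) -> total_on C subset ->
     Q (\bigcup_(X in C) X)) ->
  exists A, [/\ J `<=` A, Q A & forall B, A `<=` B -> Q B -> B = A].
Proof.
move=> QJ Qchain.
have [C CQ Ctot|A [QA Amax]] := @Zorn_bigcup T [set A | Q (J `|` A)].
  rewrite /=.
  have -> : J `|` \bigcup_(X in C) X =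
            \bigcup_(X in [set Y | Y = J \/ exists2 X, C X & Y = J `|` X]) X.
    apply/seteqP; split=> x.
      case=> [Jx|[X CX Xx]]; first by exists J => //; left.
      by exists (J `|` X); [right; exists X|right].
    case=> Y [->|[X CX ->]]; first by left.
    by case=> [|Xx]; [left|right; exists X].
  apply: Qchain; first by left.
    move=> Y [->|[X CX ->]]; first by split.
    by split; [exact: subsetUl|exact: CQ].
  move=> Y Z [->|[X CX ->]] [->|[X' CX' ->]].
  - by left.
  - by left; exact: subsetUl.
  - by right; exact: subsetUl.
  - by case: (Ctot _ _ CX CX') => XX'; [left|right]; apply: setUS.
have QA' : Q (J `|` A) by [].
exists (J `|` A); split; [exact: subsetUl|exact: QA|].
move=> B AB QB; apply: contrapT => nBA.
have nsub : ~ B `<=` A.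
  by move=> BA; apply: nBA; apply/seteqP; split=> // x Bx; right; exact: BA.
have AB' : A `<=` B by move=> x Ax; apply: AB; right.
have JB : J `|` B = B by apply/setUidPr => x Jx; apply: AB; left.
apply: (Amax B); last by rewrite /= JB.
by split.
Qed.

(** * Submodules, maximal ideals and localizations of a subring of a field *)

Section Subring.
Variables (F : fieldType) (D : set F).
Hypothesis ringD : subring D.

Lemma subring0 : D 0. Proof. by case: ringD. Qed.
Lemma subring1 : D 1. Proof. by case: ringD. Qed.
Lemma subringB x y : D x -> D y -> D (x - y). Proof. by case: ringD => _ _ + _; exact. Qed.
Lemma subringM x y : D x -> D y -> D (x * y). Proof. by case: ringD => _ _ _; exact. Qed.
Lemma subringN x : D x -> D (- x).
Proof. by move=> Dx; rewrite -sub0r; apply: subringB => //; exact: subring0. Qed.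
Lemma subringD x y : D x -> D y -> D (x + y).
Proof. by move=> Dx Dy; rewrite -[y]opprK; apply: subringB => //; apply: subringN. Qed.

Lemma submodule_ring : submodule D D.
Proof. by split; [exact: subring0|exact: subringD|exact: subringM]. Qed.

Lemma submodule_sum (I : set F) n (a : 'I_n -> F) :
  submodule D I -> (forall i, I (a i)) -> I (\sum_i a i).
Proof. by case=> I0 ID _ Ia; elim/big_ind: _ => // i _; exact: Ia. Qed.

Lemma submoduleB (I : set F) x y : submodule D I -> I x -> I y -> I (x - y).
Proof.
case=> _ ID IM Ix Iy; apply: ID => //; rewrite -mulN1r; apply: IM => //.
exact/subringN/subring1.
Qed.

Lemma submodule_set0 : submodule D [set 0].
Proof. by split=> //= [x y -> ->|r x _ ->]; rewrite ?addr0 ?mulr0. Qed.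

Lemma submodule_scale (I : set F) z : submodule D I -> submodule D [set x | I (z * x)].
Proof.
case=> I0 ID IM; split=> /= [|x y Ix Iy|r x Dr Ix]; first by rewrite mulr0.
  by rewrite mulrDr; apply: ID.
by rewrite mulrCA; apply: IM.
Qed.

Lemma submodule_colon (A B : set F) : submodule D A -> submodule D (colon A B).
Proof.
case=> A0 AD AM; split=> [b _|x y Ax Ay b Bb|r x Dr Ax b Bb].
- by rewrite mul0r.
- by rewrite mulrDl; apply: AD; [apply: Ax|apply: Ay].
- by rewrite -mulrA; apply: AM => //; apply: Ax.
Qed.

Lemma mem_span s y : y \in s -> span D s y.
Proof.
move=> ys; exists (mkseq (fun i => if i == index y s then 1 else 0) (size s)).
split; first by rewrite size_mkseq.
  move=> i lti; rewrite nth_mkseq //; case: ifP => _; [exact: subring1|exact: subring0].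
have lti : (index y s < size s)%N by rewrite index_mem.
rewrite (bigD1 (Ordinal lti)) //= nth_mkseq // eqxx mul1r nth_index // big1 ?addr0 //.
move=> i; rewrite -val_eqE /= => /negPf ni; by rewrite nth_mkseq // ni mul0r.
Qed.

Lemma span_min (I : set F) s :
  submodule D I -> (forall y, y \in s -> I y) -> span D s `<=` I.
Proof.
move=> subI sI x [r [_ Dr ->]]; apply: submodule_sum => // i.
by case: subI => _ _; apply; [exact: Dr|apply/sI/mem_nth].
Qed.

Lemma span_submodule s : submodule D (span D s).
Proof.
split.
- exists (nseq (size s) 0); split; first by rewrite size_nseq.
    by move=> i lti; rewrite nth_nseq lti; exact: subring0.
  by rewrite big1 // => i _; rewrite nth_nseq ltn_ord mul0r.
- move=> _ _ [r [_ Dr ->]] [r' [_ Dr' ->]].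
  exists (mkseq (fun i => r`_i + r'`_i) (size s)); split; first by rewrite size_mkseq.
    by move=> i lti; rewrite nth_mkseq //; apply: subringD; [exact: Dr|exact: Dr'].
  by rewrite -big_split /=; apply: eq_bigr => i _; rewrite nth_mkseq // mulrDl.
- move=> a _ Da [r [_ Dr ->]].
  exists (mkseq (fun i => a * r`_i) (size s)); split; first by rewrite size_mkseq.
    by move=> i lti; rewrite nth_mkseq //; apply: subringM => //; exact: Dr.
  by rewrite mulr_sumr; apply: eq_bigr => i _; rewrite nth_mkseq // mulrA.
Qed.

Lemma prodm_mem (I J : set F) a b : I a -> J b -> prodm I J (a * b).
Proof.
move=> Ia Jb; exists 1%N, (fun=> a), (fun=> b); split=> //.
by rewrite big_ord_recl big_ord0 addr0.
Qed.

Lemma prodm_min (I J A : set F) :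
  submodule D A -> (forall a b, I a -> J b -> A (a * b)) -> prodm I J `<=` A.
Proof.
move=> subA IJA x [n [a [b [IJ ->]]]].
by apply: submodule_sum => // i; apply: IJA; case: (IJ i (ltn_ord i)).
Qed.

Lemma prodm_submodule (I J : set F) : submodule D I -> submodule D (prodm I J).
Proof.
case=> I0 ID IM; split.
- by exists 0%N, (fun=> 0), (fun=> 0); rewrite big_ord0.
- move=> _ _ [n [a [b [IJ ->]]]] [m [a' [b' [IJ' ->]]]].
  exists (n + m)%N, (fun i => if (i < n)%N then a i else a' (i - n)%N),
         (fun i => if (i < n)%N then b i else b' (i - n)%N); split.
    move=> i lti; case: ltnP => hi; first exact: IJ.
    by apply: IJ'; rewrite ltn_subLR.
  rewrite big_split_ord /=; congr (_ + _); apply: eq_bigr => i _; first by rewrite ltn_ord.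
  by rewrite ltnNge leq_addr /= addKn.
- move=> r _ Dr [n [a [b [IJ ->]]]].
  exists n, (fun i => r * a i), b; split.
    by move=> i lti; have [Ia Jb] := IJ _ lti; split=> //; apply: IM.
  by rewrite mulr_sumr; apply: eq_bigr => i _; rewrite mulrA.
Qed.

Lemma idealDP (I : set F) : ideal D I -> (I <> D <-> ~ I 1).
Proof.
case=> -[I0 ID IM] ID'; split=> [nID I1|nI1 ID1]; last by apply: nI1; rewrite ID1; exact: subring1.
apply: nID; apply/seteqP; split=> // x Dx; by rewrite -[x]mulr1; apply: IM.
Qed.

Lemma ideal_addMr (I : set F) a : ideal D I -> D a ->
  ideal D [set x | exists m r, [/\ I m, D r & x = m + r * a]].
Proof.
move=> [subI ID] Da; have [I0 IA IM] := subI; split; last first.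
  by move=> x [m [r [Im Dr ->]]]; apply: subringD; [exact: ID|exact: subringM].
split.
- by exists 0, 0; split=> //; [exact: subring0|rewrite mul0r addr0].
- move=> _ _ [m [r [Im Dr ->]]] [m' [r' [Im' Dr' ->]]].
  exists (m + m'), (r + r'); split; [exact: IA|exact: subringD|by rewrite mulrDl addrACA].
- move=> c _ Dc [m [r [Im Dr ->]]]; exists (c * m), (c * r).
  by split; [exact: IM|exact: subringM|rewrite mulrDr mulrA].
Qed.

(* With [E s := 1 \in s] this yields maximal ideals, with [E s] saying that [s] generates an
   ideal with t-closure [D] it yields t-maximal ideals. *)
Lemma maximal_avoiding (E : seq F -> Prop) (J : set F) :
  ideal D J -> (forall s, (forall y, y \in s -> J y) -> ~ E s) ->
  exists M, [/\ J `<=` M, ideal D M, (forall s, (forall y, y \in s -> M y) -> ~ E s) &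
    forall N, ideal D N -> M `<=` N -> (forall s, (forall y, y \in s -> N y) -> ~ E s) ->
      N = M].
Proof.
move=> idJ JE.
have [|C CJ CQ Ctot|M [JM [idM ME] Mmax]] :=
  @zorn_above F J [set N | ideal D N /\ forall s, (forall y, y \in s -> N y) -> ~ E s].
- by split.
(* A finite list in the union of the chain already lies in one member, so [E], which is tested on
   lists only, passes to unions. The empty list falls back on [J]. *)
- have fin (s : seq F) : (forall y, y \in s -> (\bigcup_(X in C) X) y) ->
      exists2 X, C X & forall y, y \in s -> X y.
    elim: s => [_|a s IH sC]; first by exists J.
    have [X CX Xs] : exists2 X, C X & forall y, y \in s -> X y.
      by apply: IH => y ys; apply: sC; rewrite inE ys orbT.
    have [Y CY Ya] := sC a (mem_head _ _).
    case: (Ctot _ _ CX CY) => XY.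
      by exists Y => // y; rewrite inE => /orP[/eqP->//|/Xs/XY].
    by exists X => // y; rewrite inE => /orP[/eqP->|/Xs//]; exact: XY.
  split; last first.
    by move=> s /fin[X CX Xs]; have [_ [_]] := CQ _ CX; apply.
  have sub X : C X -> submodule D X by move=> /CQ[_ [[]]].
  split; last by move=> x [X /CQ[_ [[_ XD] _]]]; exact: XD.
  split.
  - by exists J => //; have [[]] := idJ.
  - move=> x y Cx Cy; have [|X CX Xs] := fin [:: x; y].
      by move=> z; rewrite in_cons mem_seq1 => /orP[]/eqP->.
    exists X => //; have [_ XA _] := sub _ CX.
    by apply: XA; apply: Xs; rewrite !inE eqxx ?orbT.
  - move=> r x Dr [X CX Xx]; exists X => //; have [_ _ XM] := sub _ CX; exact: XM.
by exists M; split=> // N idN MN NE; apply: Mmax.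
Qed.

Lemma max_ideal_exists J : ideal D J -> ~ J 1 -> exists2 M, max_ideal D M & J `<=` M.
Proof.
move=> idJ nJ1; have [|M [JM idM ME Mmax]] := @maximal_avoiding (fun s => 1 \in s) J idJ.
  by move=> s sJ /sJ.
have prop N : ideal D N -> N <> D -> forall s, (forall y, y \in s -> N y) -> ~ 1 \in s.
  by move=> idN /(idealDP idN) nN1 s sN /sN.
exists M => //; split=> //.
  apply/idealDP => // M1; apply: (ME [:: 1]); last by rewrite mem_head.
  by move=> y; rewrite inE => /eqP->.
by move=> N idN nND MN; apply: Mmax => //; exact: prop.
Qed.

Lemma max_ideal_prime M : max_ideal D M -> prime_ideal D M.
Proof.
move=> [idM nMD Mmax]; split=> // a b Da Db Mab; apply: contrapT => /not_orP[nMa nMb].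
pose N := [set x | exists m r, [/\ M m, D r & x = m + r * a]].
have idN : ideal D N := ideal_addMr idM Da.
have [[M0 MA MM] MD] := idM.
have MN : M `<=` N.
  by move=> m Mm; exists m, 0; rewrite mul0r addr0; split=> //; exact: subring0.
have Na : N a by exists 0, 1; rewrite mul1r add0r; split=> //; exact: subring1.
have [m [r [Mm Dr E]]] : N 1.
  apply: contrapT => nN1; apply: nMa; rewrite -(Mmax N) //; exact/idealDP.
apply: nMb; rewrite -[b]mul1r E mulrDl; apply: MA.
  by rewrite mulrC; apply: MM.
by rewrite -mulrA; apply: MM.
Qed.

(** When 0 is maximal, the ideal generated by [y] is all of [D]. This will exclude 0 from the
    maximal ideals of the Nagata ring. *)
Lemma max_ideal0_inv y : max_ideal D [set 0] -> D y -> y != 0 -> D y^-1.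
Proof.
move=> [id0 _ max0] Dy y0.
pose N := [set x | exists m r, [/\ [set 0] m, D r & x = m + r * y]].
have idN : ideal D N := ideal_addMr id0 Dy.
have [N1|nN1] := pselect (N 1).
  have [m [r [-> Dr]]] := N1; rewrite add0r => E.
  by rewrite -[y^-1]mul1r E mulfK.
have N0 : N = [set 0].
  apply: max0 => //; first exact/idealDP.
  by move=> x ->; case: idN => -[].
have : N y by exists 0, 1; rewrite add0r mul1r; split=> //; exact: subring1.
by rewrite N0 => /eqP; rewrite (negPf y0).
Qed.

Lemma prime1 (P : set F) : prime_ideal D P -> ~ P 1.
Proof. by case=> idP nPD _; apply/idealDP. Qed.

Lemma loc_incl (P : set F) : prime_ideal D P -> D `<=` loc D P.
Proof.
move=> pP x Dx; exists 1; rewrite mul1r; split=> //; [exact: subring1|exact: prime1].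
Qed.

Lemma prime_compl (P : set F) a b : prime_ideal D P -> D a -> D b -> ~ P a -> ~ P b ->
  ~ P (a * b).
Proof. by case=> _ _ pP Da Db nPa nPb /(pP _ _ Da Db)[]. Qed.

Lemma loc_subring (P : set F) : prime_ideal D P -> subring (loc D P).
Proof.
move=> pP; split; try by apply: loc_incl => //; [exact: subring0|exact: subring1].
- exact: loc_incl subring0.
- exact: loc_incl subring1.
- move=> x y [s [Ds nPs Dsx]] [t [Dt nPt Dty]]; exists (s * t).
  split; [exact: subringM|exact: prime_compl|].
  rewrite mulrBr; apply: subringB; first by rewrite mulrAC; exact: subringM.
  by rewrite -mulrA; exact: subringM.
- move=> x y [s [Ds nPs Dsx]] [t [Dt nPt Dty]]; exists (s * t).
  split; [exact: subringM|exact: prime_compl|].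
  by rewrite mulrACA; exact: subringM.
Qed.

End Subring.

(** * The t-operation and t-invertibility *)

Section TOperation.
Variables (F : fieldType) (D : set F).
Hypothesis ringD : subring D.

(* The v-closure of the finitely generated submodule [span D s], in terms of its generators. *)
Definition vcl (s : seq F) : set F :=
  [set x | forall z, (forall y, y \in s -> D (z * y)) -> D (z * x)].

Lemma vcl_mem s y : y \in s -> vcl s y.
Proof. by move=> ys z; apply. Qed.

Lemma vcl_trans s u x : (forall y, y \in s -> vcl u y) -> vcl s x -> vcl u x.
Proof. by move=> su sx z zu; apply: sx => y ys; apply: su. Qed.

Lemma vcl_sub s u x : {subset s <= u} -> vcl s x -> vcl u x.
Proof. by move=> su; apply: vcl_trans => y /su; exact: vcl_mem. Qed.

Lemma vclos_span s : vclos D (span D s) = vcl s.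
Proof.
apply/seteqP; split=> x /= vx z zs; rewrite ?[x * _]mulrC.
  rewrite mulrC; apply: vx.
  exact: (span_min (submodule_scale z (submodule_ring ringD)) zs).
by apply: vx => y ys; apply: zs; exact: mem_span.
Qed.

Lemma span_neq0 s : span D s <> [set 0] <-> exists2 y, y \in s & y != 0.
Proof.
split=> [s0|[y ys /eqP y0] s0]; last first.
  by apply: y0; rewrite -[_ = _]/([set 0] y) -s0; exact: mem_span.
apply: contrapT => ns; apply: s0; apply/seteqP; split=> x; last first.
  by move=> ->; case: (span_submodule ringD s).
apply: span_min => //; first exact: submodule_set0.
by move=> y ys /=; apply: contrapT => /eqP y0; apply: ns; exists y.
Qed.

Lemma tclosP I x : submodule D I ->
  tclos D I x <->
  exists s, [/\ forall y, y \in s -> I y, exists2 y, y \in s & y != 0 & vcl s x].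
Proof.
move=> subI; split=> -[s].
  by rewrite vclos_span => -[sI /span_neq0 s0 vx]; exists s; split=> // y ys; apply/sI/mem_span.
case=> sI /span_neq0 s0 vx; exists s; rewrite vclos_span; split=> //; exact: span_min.
Qed.

Section Submodule.
Variable I : set F.
Hypothesis subI : submodule D I.

(** Finitely many witnesses are concatenated into one list; a nonzero element of [I] seeds it.
    Additivity and idempotence of the t-closure both rest on this. *)
Lemma tclos_seq (s : seq F) : (forall y, y \in s -> tclos D I y) ->
  (exists2 y, I y & y != 0) ->
  exists u, [/\ forall y, y \in u -> I y, exists2 y, y \in u & y != 0 &
                forall y, y \in s -> vcl u y].
Proof.
move=> + [y0 Iy0 ny0]; elim: s => [_|a s IH sI].
  by exists [:: y0]; split=> // [y|]; [rewrite inE => /eqP->|exists y0 => //; exact: mem_head].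
have [|u [uI [y yu ny] su]] := IH.
  by move=> y ys; apply: sI; rewrite inE ys orbT.
have /(tclosP _ subI)[v [vI _ va]] := sI a (mem_head _ _).
exists (v ++ u); split.
- by move=> z; rewrite mem_cat => /orP[/vI|/uI].
- by exists y => //; rewrite mem_cat yu orbT.
- move=> z; rewrite inE => /orP[/eqP->|/su].
    by apply: vcl_sub va => t tv; rewrite mem_cat tv.
  by apply: vcl_sub => t tu; rewrite mem_cat tu orbT.
Qed.

Hypothesis I0 : I <> [set 0].

Lemma submodule_neq0 : exists2 y, I y & y != 0.
Proof.
apply: contrapT => nI; apply: I0; apply/seteqP; split=> x; last first.
  by move=> ->; case: subI.
by move=> Ix; apply: contrapT => /eqP x0; apply: nI; exists x.
Qed.

Lemma tclos_incl : I `<=` tclos D I.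
Proof.
move=> x Ix; have [y Iy y0] := submodule_neq0; apply/tclosP => //.
exists [:: x; y]; split.
- by move=> z; rewrite in_cons mem_seq1 => /orP[]/eqP->.
- by exists y; rewrite // !inE eqxx orbT.
- by apply: vcl_mem; exact: mem_head.
Qed.

Lemma tclos_submodule : submodule D (tclos D I).
Proof.
have [I0' IA IM] := subI.
split; first exact: tclos_incl.
- move=> x y tx ty; apply/tclosP => //.
  have [|u [uI u0 us]] := tclos_seq (s := [:: x; y]) _ submodule_neq0.
    by move=> z; rewrite in_cons mem_seq1 => /orP[]/eqP->.
  exists u; split=> // z zu; rewrite mulrDr.
  by apply: subringD => //; apply: us => //; rewrite !inE eqxx ?orbT.
- move=> r x Dr /(tclosP _ subI)[s [sI s0 sx]]; apply/tclosP => //.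
  by exists s; split=> // z zs; rewrite mulrCA; apply: subringM => //; exact: sx.
Qed.

Lemma tclos_id : tclos D (tclos D I) = tclos D I.
Proof.
apply/seteqP; split=> x; last first.
  move=> tx; apply/(tclosP _ tclos_submodule).
  have [y Iy y0] := submodule_neq0; exists [:: x; y]; split.
  - move=> z; rewrite in_cons mem_seq1 => /orP[]/eqP-> //; exact: tclos_incl Iy.
  - by exists y; rewrite // !inE eqxx orbT.
  - by apply: vcl_mem; exact: mem_head.
move/(tclosP _ tclos_submodule) => [s [sI s0 sx]].
have [u [uI u0 us]] := tclos_seq sI submodule_neq0.
by apply/tclosP => //; exists u; split=> //; exact: vcl_trans sx.
Qed.

End Submodule.

Lemma tclos_mono I J : I `<=` J -> tclos D I `<=` tclos D J.
Proof. by move=> IJ x [s [sI s0 sx]]; exists s; split=> //; exact: subset_trans sI IJ. Qed.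

Lemma tclos_sub_ring I : I `<=` D -> tclos D I `<=` D.
Proof.
move=> ID x [s [sI _]]; rewrite vclos_span => /(_ 1); rewrite mul1r; apply=> y ys.
by rewrite mul1r; apply/ID/sI/mem_span.
Qed.

Lemma ideal_t_ideal I : ideal D I -> I <> [set 0] -> tclos D I `<=` I -> t_ideal D I.
Proof.
move=> [subI ID] I0 tI; split; last by apply/seteqP; split=> //; exact: tclos_incl.
split=> //; exists 1; split; [exact: oner_neq0|exact: subring1|].
by move=> x Ix; rewrite mul1r; exact: ID.
Qed.

Lemma t_max_exists J : ideal D J -> J <> [set 0] -> ~ tclos D J 1 ->
  exists2 M, t_max D M & J `<=` M.
Proof.
move=> idJ J0 nJ1.
pose E (s : seq F) := (exists2 y, y \in s & y != 0) /\ vcl s 1.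
have avoidP N : ideal D N ->
    (forall s, (forall y, y \in s -> N y) -> ~ E s) <-> ~ tclos D N 1.
  move=> [subN _]; split=> [NE|nN s sN [s0 s1]].
    by move=> /(tclosP _ subN)[s [sN s0 s1]]; apply: (NE s).
  by apply: nN; apply/tclosP => //; exists s.
have [|M [JM idM /(avoidP _ idM) nM1 Mmax]] := @maximal_avoiding _ _ E J idJ.
  exact/avoidP.
have [subM MD] := idM.
have M0 : M <> [set 0].
  have [y Jy /eqP y0] := submodule_neq0 idJ.1 J0.
  by move=> M0; apply: y0; rewrite -[_ = _]/([set 0] y) -M0; exact: JM.
have MtM := tclos_incl subM M0.
have idtM : ideal D (tclos D M).
  by split; [exact: tclos_submodule|exact: tclos_sub_ring].
(* By idempotence, [tclos D M] still avoids [E]; maximality of [M] then makes it a t-ideal. *)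
have tM : t_ideal D M.
  apply: ideal_t_ideal => //; rewrite (_ : tclos D M = M) //; apply: Mmax => //.
  by apply/avoidP => //; rewrite tclos_id.
exists M => //; split=> //.
  by apply/(idealDP ringD idM) => M1; apply: nM1; exact: MtM.
move=> N idN nN [fN tN] MN; apply: Mmax => //; apply/avoidP => //; rewrite tN.
exact/(idealDP ringD idN).
Qed.

Lemma t_max_prime M : t_max D M -> prime_ideal D M.
Proof.
move=> [idM nMD [fM tM] Mmax]; split=> // a b Da Db Mab.
apply: contrapT => /not_orP[nMa nMb].
pose N := [set x | exists m r, [/\ M m, D r & x = m + r * a]].
have idN : ideal D N := ideal_addMr ringD idM Da.
have [subM MD] := idM; have [M0 MA MM] := subM.
have MN : M `<=` N.
  by move=> m Mm; exists m, 0; rewrite mul0r addr0; split=> //; exact: subring0.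
have Na : N a by exists 0, 1; rewrite mul1r add0r; split=> //; exact: subring1.
have b0 : b != 0 by apply: contra_notN nMb => /eqP->.
have [_ nM0 _] := fM.
have nN0 : N <> [set 0].
  have [y My /eqP y0] := submodule_neq0 subM nM0.
  by move=> N0; apply: y0; rewrite -[_ = _]/([set 0] y) -N0; exact: MN.
have [subN ND] := idN.
have tN1 : tclos D N 1.
  apply: contrapT => ntN1; apply: nMa.
  have idtN : ideal D (tclos D N) by split; [exact: tclos_submodule|exact: tclos_sub_ring].
  have NtN := tclos_incl subN nN0.
  rewrite -(Mmax (tclos D N)) //; first exact/NtN.
  - exact/(idealDP ringD idtN).
  - apply: ideal_t_ideal => //; last by rewrite tclos_id.
    have [y Ny /eqP y0] := submodule_neq0 subN nN0.
    by move=> N0; apply: y0; rewrite -[_ = _]/([set 0] y) -N0; exact: NtN.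
  - exact: subset_trans MN NtN.
move: tN1 => /(tclosP _ subN)[s [sN [y ys y0] s1]].
(* Since [a * b] is in [M], multiplication by [b] sends the list [s] into [M]. As 1 is in the
   v-closure of [s], [b] is in the t-closure of [M]. *)
apply: nMb; rewrite -tM; apply/tclosP => //; exists [seq b * y | y <- s]; split.
- move=> _ /mapP[x /sN[m [r [Mm Dr ->]]] ->]; rewrite mulrDr; apply: MA; first exact: MM.
  by rewrite mulrCA; apply: MM => //; rewrite mulrC.
- by exists (b * y); [exact: map_f|exact: mulf_neq0].
- move=> z zb; rewrite -[b]mulr1 mulrA; apply: s1 => x xs.
  by rewrite -mulrA; apply/zb/map_f.
Qed.

Hypothesis fracD : forall x, exists d, [/\ D d, d != 0 & D (d * x)].

Lemma common_denom (s : seq F) :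
  exists d, [/\ D d, d != 0 & forall y, y \in s -> D (d * y)].
Proof.
elim: s => [|a s [d [Dd d0 ds]]]; first by exists 1; split; [exact: subring1|exact: oner_neq0|].
have [e [De e0 ea]] := fracD a; exists (d * e); split; [exact: subringM|exact: mulf_neq0|].
move=> y; rewrite inE => /orP[/eqP->|/ds dy]; first by rewrite -mulrA; exact: subringM.
by rewrite mulrAC mulrC; exact: subringM.
Qed.

Hypothesis pvmd : PvMD D.

(* [bs] lies in the inverse of [span D s], and the second clause says that the fractional ideal
   generated by the products [y * b] has v-closure [D]. *)
Lemma t_invertible (s : seq F) : (exists2 y, y \in s & y != 0) ->
  exists bs : seq F, (forall y b, y \in s -> b \in bs -> D (y * b)) /\
    (forall z, (forall y b, y \in s -> b \in bs -> D (z * (y * b))) -> D z).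
Proof.
move=> [y0 y0s ny0].
pose inv (bs : seq F) := forall y b, y \in s -> b \in bs -> D (y * b).
(* [J] is the trace ideal: the product of [span D s] with its inverse, built from finite lists in
   the inverse. The goal is that its t-closure contains 1. *)
pose J : set F := [set x | exists2 bs, inv bs & span D [seq y * b | y <- s, b <- bs] x].
have Jmono bs bs' : {subset bs <= bs'} ->
    span D [seq y * b | y <- s, b <- bs] `<=` span D [seq y * b | y <- s, b <- bs'].
  move=> sub; apply: span_min => //; first exact: span_submodule.
  move=> _ /allpairsP[[y b] [/= ys bbs ->]]; apply: mem_span => //.
  by apply: allpairs_f => //; exact: sub.
have invU bs bs' : inv bs -> inv bs' -> inv (bs ++ bs').
  by move=> i i' y b ys; rewrite mem_cat => /orP[]; [exact: i|exact: i'].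
have subl (bs bs' : seq F) : {subset bs <= bs ++ bs'} by move=> b; rewrite mem_cat => ->.
have subr (bs bs' : seq F) : {subset bs' <= bs ++ bs'}.
  by move=> b; rewrite mem_cat => ->; rewrite orbT.
have subJ : submodule D J.
  split.
  - by exists [::] => //; case: (span_submodule ringD [seq y * b | y <- s, b <- [::]]).
  - move=> x y [bs i xs] [bs' i' ys]; exists (bs ++ bs'); first exact: invU.
    have [_ + _] := span_submodule ringD [seq y * b | y <- s, b <- bs ++ bs'].
    by apply; [exact: Jmono xs|exact: Jmono ys].
  - move=> r x Dr [bs i xs]; exists bs => //.
    by have [_ _] := span_submodule ringD [seq y * b | y <- s, b <- bs]; apply.
have JD : J `<=` D.
  move=> x [bs i]; apply: span_min => //; first exact: submodule_ring.
  by move=> _ /allpairsP[[y b] [/= ys bbs ->]]; exact: i.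
have Jmem y b : y \in s -> (forall y, y \in s -> D (y * b)) -> J (y * b).
  move=> ys sb; exists [:: b]; first by move=> y' b' /sb y's; rewrite inE => /eqP->.
  by apply: mem_span => //; apply: allpairs_f => //; exact: mem_head.
have J0 : J <> [set 0].
  have [d [Dd d0 ds]] := common_denom s => J0.
  have : J (y0 * d) by apply: Jmem => // y /ds; rewrite mulrC.
  by rewrite J0 /=; apply/eqP; exact: mulf_neq0.
have J1 : tclos D J 1.
  apply: contrapT => nJ1.
  have [M tM JM] := t_max_exists (conj subJ JD) J0 nJ1.
  have pM := t_max_prime tM; have valM := pvmd tM.
  have locR := loc_subring ringD pM.
  (* In the valuation domain [loc D M] some nonzero [a] in [s] divides every element of [s]. *)
  have [a [as_ a0 sa]] : exists a, [/\ a \in s, a != 0 &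
      forall y, y \in s -> loc D M (y / a)].
    have gen (r : seq F) : {subset r <= s} -> exists a, [/\ a \in s, a != 0 &
        forall y, y \in r -> loc D M (y / a)].
      elim: r => [|c r IH] rs; first by exists y0.
      have [|a [as_ a0 ra]] := IH; first by move=> y yr; apply: rs; rewrite inE yr orbT.
      have [->|c0] := eqVneq c 0.
        exists a; split=> // y; rewrite inE => /orP[/eqP->|/ra//].
        by rewrite mul0r; exact: subring0.
      have /valM[cal|] : c / a != 0 by rewrite mulf_neq0 ?invr_neq0.
        by exists a; split=> // y; rewrite inE => /orP[/eqP->|/ra].
      rewrite invf_div => acl; exists c; split=> //; first by apply: rs; exact: mem_head.
      move=> y; rewrite inE => /orP[/eqP->|/ra yal]; first by rewrite divff //; exact: subring1.
      have -> : y / c = (y / a) * (a / c) by rewrite mulrA divfK.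
      exact: subringM.
    exact: gen.
  (* A common denominator [t] outside [M] puts [t / a] in the inverse of [s], so [t], being the
     product of [a] and [t / a], lies in [J] and hence in [M]: a contradiction. *)
  have [t [Dt nMt ts]] : exists t, [/\ D t, ~ M t & forall y, y \in s -> D (t * (y / a))].
    elim: (s) sa => [|c r IH] ra.
      by exists 1; split=> //; [exact: subring1|exact: (prime1 ringD pM)].
    have [|t [Dt nMt tr]] := IH; first by move=> y yr; apply: ra; rewrite inE yr orbT.
    have [e [De nMe ec]] := ra c (mem_head _ _).
    exists (e * t); split; [exact: subringM|exact: (prime_compl pM)|].
    move=> y; rewrite inE => /orP[/eqP->|/tr ty]; first by rewrite mulrAC mulrC; exact: subringM.
    by rewrite -mulrA; exact: subringM.
  apply: nMt; rewrite -[t](@mulfVK _ a) // mulrC; apply: JM; apply: Jmem => // y ys.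
  by rewrite mulrCA; exact: ts.
move: J1 => /(tclosP _ subJ)[u [uJ _ u1]].
(* The finite list [u] involves only finitely many elements of the inverse; their concatenation is
   the required list. *)
have [bs i ubs] : exists2 bs, inv bs &
    forall x, x \in u -> span D [seq y * b | y <- s, b <- bs] x.
  elim: u uJ {u1} => [_|x u IH xuJ]; first by exists [::].
  have [bs i xbs] := xuJ x (mem_head _ _).
  have [|bs' i' ubs] := IH; first by move=> y yu; apply: xuJ; rewrite inE yu orbT.
  exists (bs ++ bs'); first exact: invU.
  by move=> y; rewrite inE => /orP[/eqP->|/ubs]; exact: Jmono.
exists bs; split=> // z zbs; rewrite -[z]mulr1; apply: u1 => x /ubs.
move: x; apply: (span_min (submodule_scale z (submodule_ring ringD))).
by move=> _ /allpairsP[[y b] [/= ys bbs ->]]; exact: zbs.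
Qed.

End TOperation.

(** * Bezout domains and their overrings *)

Section Localizations.
Variables (F : fieldType) (D : set F).
Hypothesis ringD : subring D.

Lemma bigloc_subring (fam : set (set F)) :
  (forall P, fam P -> prime_ideal D P) -> subring (bigloc D fam).
Proof.
move=> famP; split.
- by move=> P /famP pP; exact: (subring0 (loc_subring ringD pP)).
- by move=> P /famP pP; exact: (subring1 (loc_subring ringD pP)).
- move=> x y fx fy P fP; apply: (subringB (loc_subring ringD (famP _ fP))).
  + exact: fx.
  + exact: fy.
- move=> x y fx fy P fP; apply: (subringM (loc_subring ringD (famP _ fP))).
  + exact: fx.
  + exact: fy.
Qed.

Lemma bigloc_incl (fam : set (set F)) :
  (forall P, fam P -> prime_ideal D P) -> D `<=` bigloc D fam.
Proof. by move=> famP x Dx P /famP pP; exact: loc_incl. Qed.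

(** The inverse of a nonzero element of [P] is missing from [loc D P]. This separates such families
    from the empty one, whose intersection is the whole field. *)
Lemma bigloc_nonzero_prime (fam : set (set F)) P :
  fam P -> prime_ideal D P -> P <> [set 0] -> bigloc D fam <> setT.
Proof.
move=> fP [[subP PD] _ _] P0 famT.
have [y Py y0] := submodule_neq0 subP P0.
have : bigloc D fam y^-1 by rewrite famT.
move=> /(_ _ fP)[s [Ds nPs Dsy]]; apply: nPs; rewrite -[s](mulfVK y0).
by case: subP => _ _; apply.
Qed.

End Localizations.

Section Bezout.
Variables (F : fieldType) (T : set F).
Hypothesis ringT : subring T.

(* [T] is a Bezout domain with quotient field [F]. *)
Definition bezout_in := forall a b, exists g a' b' u v,
  [/\ T a', T b', T u & T v] /\ [/\ a = g * a', b = g * b' & u * a' + v * b' = 1].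

Hypothesis bezT : bezout_in.

(** The Bezout property is applied to [x] and 1: from 1 = [g * b] the common factor [g] is the
    inverse of [b]. *)
Lemma coprime_frac x : exists a b u v,
  [/\ T a, T b, T u & T v] /\ [/\ b != 0, x = a / b & u * a + v * b = 1].
Proof.
have [g [a [b [u [v [Ts [-> E uv]]]]]]] := bezT x 1.
have b0 : b != 0 by apply/eqP => b0; move/eqP: E; rewrite b0 mulr0 oner_eq0.
exists a, b, u, v; split=> //; split=> //.
by rewrite mulrC; congr (_ * _); apply: (mulIf b0); rewrite -E mulVf.
Qed.

Section Overring.
Variable S : set F.
Hypotheses (ringS : subring S) (TS : T `<=` S).

(** If [b] is in [Q] and [s * (a / b)] is in [S] with [s] outside [Q], then [s * a] is in [Q], hence
    so is [a], and the Bezout relation puts 1 in [Q]. Membership in a localization thus depends only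
    on the reduced denominator, which lies in [T]. *)
Lemma loc_coprime Q a b u v : prime_ideal S Q ->
  T a -> T b -> T u -> T v -> b != 0 -> u * a + v * b = 1 ->
  loc S Q (a / b) <-> ~ Q b.
Proof.
move=> pQ Ta Tb Tu Tv b0 uv; split; last first.
  by move=> nQb; exists b; split=> //; [exact: TS|rewrite mulrC divfK //; exact: TS].
move=> [s [Ss nQs Ssab]] Qb.
have [[[Q0 QA QM] QS] QnS Qp] := pQ.
have Qsa : Q (s * a).
  by rewrite -[a](divfK b0) mulrA; apply: QM.
have [|Qa] := Qp _ _ Ss (TS Ta) Qsa; first exact: nQs.
apply: (prime1 ringS pQ); rewrite -uv; apply: QA; apply: QM => //; exact: TS.
Qed.

Lemma contr_prime Q : prime_ideal S Q -> prime_ideal T (Q `&` T).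
Proof.
move=> pQ; have [[[Q0 QA QM] QS] _ Qp] := pQ.
have idQT : ideal T (Q `&` T).
  split; last by move=> x [].
  split; first by split; last exact: subring0.
    by move=> x y [Qx Tx] [Qy Ty]; split; [exact: QA|exact: subringD].
  by move=> r x Tr [Qx Tx]; split; [apply: QM => //; exact: TS|exact: subringM].
split=> //; first by apply/idealDP => // -[Q1 _]; exact: (prime1 ringS pQ).
by move=> a b Ta Tb [Qab _]; case: (Qp a b (TS Ta) (TS Tb) Qab); [left|right].
Qed.

End Overring.

Lemma loc_contr S Q : subring S -> T `<=` S -> prime_ideal S Q ->
  loc S Q = loc T (Q `&` T).
Proof.
move=> ringS TS pQ; have pQT := contr_prime ringS TS pQ.
apply/seteqP; split=> x; have [a [b [u [v [[Ta Tb Tu Tv] [b0 -> uv]]]]]] := coprime_frac x.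
  move=> /(loc_coprime ringS TS pQ Ta Tb Tu Tv b0 uv) nQb.
  by apply/(loc_coprime ringT (fun _ => id) pQT Ta Tb Tu Tv b0 uv) => -[].
move=> /(loc_coprime ringT (fun _ => id) pQT Ta Tb Tu Tv b0 uv) nQb.
by apply/(loc_coprime ringS TS pQ Ta Tb Tu Tv b0 uv) => Qb; apply: nQb.
Qed.

(** Write [x] in [Q] as a reduced fraction [a / b]. Since [x] lies in [S], [b] is outside [Q'],
    while [a] = [b * x] is in the contraction of [Q], hence in [Q']. *)
Lemma contr_sub S Q Q' : subring S -> T `<=` S -> prime_ideal S Q -> prime_ideal S Q' ->
  Q `&` T `<=` Q' -> Q `<=` Q'.
Proof.
move=> ringS TS pQ pQ' QQ' x Qx.
have [a [b [u [v [[Ta Tb Tu Tv] [b0 xab uv]]]]]] := coprime_frac x.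
have [[[_ _ QM] QS] _ _] := pQ; have [_ _ Qp'] := pQ'.
have nQb : ~ Q' b.
  apply/(loc_coprime ringS TS pQ' Ta Tb Tu Tv b0 uv); rewrite -xab.
  by apply: loc_incl => //; exact: QS.
have aE : a = b * x by rewrite xab mulrC divfK.
have Qa : Q a by rewrite aE; apply: QM => //; exact: TS.
have : Q' (b * x) by rewrite -aE; apply: QQ'.
by case/Qp' => //; [exact: TS|exact: QS].
Qed.

Lemma contr_inj S Q Q' : subring S -> T `<=` S -> prime_ideal S Q -> prime_ideal S Q' ->
  Q `&` T = Q' `&` T -> Q = Q'.
Proof.
move=> ringS TS pQ pQ' QQ'; apply/seteqP; split.
  by apply: (contr_sub ringS TS pQ pQ'); rewrite QQ' => x [].
by apply: (contr_sub ringS TS pQ' pQ); rewrite -QQ' => x [].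
Qed.

(** Given [a] in [P] only and [b] in [Q] only, divide out the common factor [g]. It lies in neither
    prime, so the coprime cofactors lie in [P] and [Q], both inside [M], which would then contain
    1. *)
Lemma primes_below_chain M P Q : prime_ideal T M -> prime_ideal T P -> prime_ideal T Q ->
  P `<=` M -> Q `<=` M -> P `<=` Q \/ Q `<=` P.
Proof.
move=> pM pP pQ PM QM.
apply: contrapT => /not_orP[/existsNP[a /not_implyP[Pa nQa]]
                           /existsNP[b /not_implyP[Qb nPb]]].
have [g [a' [b' [u [v [[Ta Tb Tu Tv] [aE bE uv]]]]]]] := bezT a b.
have [[[M0 MA MM] MT] _ _] := pM.
have [[[_ _ Pm] PT] _ Pp] := pP; have [[[_ _ Qm] QT] _ Qp] := pQ.
have Tg : T g.
  rewrite -[g]mulr1 -uv mulrDr mulrCA -aE mulrCA -bE.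
  by apply: subringD => //; apply: subringM => //; [exact: PT|exact: QT].
have Pa' : P a'.
  have : P (g * a') by rewrite -aE.
  by case/Pp => // Pg; case: nPb; rewrite bE mulrC; apply: Pm.
have Qb' : Q b'.
  have : Q (g * b') by rewrite -bE.
  by case/Qp => // Qg; case: nQa; rewrite aE mulrC; apply: Qm.
apply: (prime1 ringT pM); rewrite -uv.
by apply: MA; apply: MM => //; [exact: PM|exact: QM].
Qed.

(** Comparing all maximal ideals with all but [M] gives an [x] outside [loc T M] only; its reduced
    denominator is [d]. If [M] is the only maximal ideal, [d] = 0 works. *)
Lemma sharp_witness M : sharp_dom T -> max_ideal T M ->
  exists2 d, M d & forall M', max_ideal T M' -> M' <> M -> ~ M' d.
Proof.
move=> shT mM; have pM := max_ideal_prime ringT mM.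
pose M2 := [set M' | max_ideal T M' /\ M' <> M].
have [[M' M2M']|none] := pselect (M2 !=set0); last first.
  exists 0; first by case: pM => -[[]].
  by move=> M' mM' nM'; case: none; exists M'.
have [x [xM2 nxM]] : exists x, bigloc T M2 x /\ ~ loc T M x.
  apply: contrapT => nx.
  apply: (shT (max_ideal T) M2); [by exists M|by exists M'|by []|by move=> ? []| |].
    by move=> E; have : max_ideal T M by []; rewrite E => -[_]; exact.
  apply/seteqP; split=> x xl; first by move=> N [mN _]; exact: xl.
  move=> N mN; have [->|nNM] := pselect (N = M); last by apply: xl.
  by apply: contrapT => nl; apply: nx; exists x.
have [a [b [u [v [[Ta Tb Tu Tv] [b0 xab uv]]]]]] := coprime_frac x.
exists b.
  apply: contrapT => nMb; apply: nxM; rewrite xab.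
  exact/(loc_coprime ringT (fun _ => id) pM Ta Tb Tu Tv b0 uv).
move=> N mN nN; have pN := max_ideal_prime ringT mN.
apply/(loc_coprime ringT (fun _ => id) pN Ta Tb Tu Tv b0 uv).
by rewrite -xab; apply: xM2.
Qed.

(** If [M] were not in [fam], a generator [e] of a finitely generated ideal inside [M] would avoid
    every member of [fam]. Its inverse would then lie in the intersection, hence in [T], although
    [e] is in [M]. *)
Lemma max_in_family (fam : set (set F)) M :
  sharp_dom T -> fam !=set0 -> (forall P, fam P -> prime_ideal T P) ->
  pairwise_incomparable fam -> bigloc T fam `<=` T -> max_ideal T M -> fam M.
Proof.
move=> shT [P0 fP0] famP inc famT mM.
have pM := max_ideal_prime ringT mM.
have [[[M0 MA MM] MT] _ _] := pM.
have [d Md dM] := sharp_witness shT mM.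
apply: contrapT => nfM.
(* At most one member of [fam] lies below [M]: primes below [M] form a chain and [fam] is
   incomparable. *)
have [y My yP] : exists2 y, M y & forall P, fam P -> P `<=` M -> ~ P y.
  have [[P [fP PM]]|none] := pselect (exists P, fam P /\ P `<=` M); last first.
    by exists 0 => // P fP PM; case: none; exists P.
  have [y [My nPy]] : exists y, M y /\ ~ P y.
    apply: contrapT => ny; apply: nfM.
    suff -> : M = P by [].
    by apply/seteqP; split=> // y My; apply: contrapT => nPy; apply: ny; exists y.
  exists y => // Q fQ QM; suff -> : Q = P by [].
  by case: (primes_below_chain pM (famP _ fP) (famP _ fQ) PM QM) => [/inc|/inc]->.
have [e [d' [y' [u [v [[Td Ty Tu Tv] [dE yE uv]]]]]]] := bezT d y.
have Me : M e.
  rewrite -[e]mulr1 -uv mulrDr mulrCA -dE mulrCA -yE.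
  by apply: MA; exact: MM.
have nPe P : fam P -> ~ P e.
  (* A member containing [e] contains [d] and [y]. By the choice of [d], [M] is the only maximal
     ideal above it, and this contradicts the choice of [y]. *)
  move=> fP; have pP := famP _ fP; have [[[P00 PA PM] PT] _ _] := pP => Pe.
  have Py : P y by rewrite yE mulrC; apply: PM.
  have Pd : P d by rewrite dE mulrC; apply: PM.
  have [N mN PN] := max_ideal_exists ringT (conj (And3 P00 PA PM) PT) (prime1 ringT pP).
  have [NM|nNM] := pselect (N = M); last exact: (dM N mN nNM (PN _ Pd)).
  by apply: (yP P fP _ Py); rewrite -NM.
have e0 : e != 0.
  by apply: contra_notN (nPe _ fP0) => /eqP->; have [[[]]] := famP _ fP0.
apply: (prime1 ringT pM); rewrite -[1](mulVf e0); apply: MM => //; apply: famT => P fP.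
exists e; rewrite divff //; split; [exact: MT|exact: nPe|exact: subring1].
Qed.

End Bezout.

Lemma bezout_overring (F : fieldType) (T S : set F) : T `<=` S -> bezout_in T -> bezout_in S.
Proof.
move=> TS bez a b; have [g [a' [b' [u [v [[Ta Tb Tu Tv] E]]]]]] := bez a b.
by exists g, a', b', u, v; split=> //; split; exact: TS.
Qed.

(** * The ##-property of a Bezout domain through incomparable primes *)

Section SharpSharp.
Variables (F : fieldType) (T : set F).
Hypotheses (ringT : subring T) (bezT : bezout_in T).

(** This is the intersection of [S] with the maximal ideal of [loc T Q]: the center on [S] when [S]
    lies in [loc T Q]. *)
Definition extend (S Q : set F) : set F :=
  [set x | S x /\ exists s, [/\ T s, ~ Q s & Q (s * x)]].

Section Extend.
Variables S Q : set F.
Hypotheses (ringS : subring S) (TS : T `<=` S) (pQ : prime_ideal T Q) (SQ : S `<=` loc T Q).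

Lemma extend_contr : extend S Q `&` T = Q.
Proof.
have [[_ QT] _ Qp] := pQ; apply/seteqP; split=> [x [[_ [s [Ts nQs Qsx]]] Tx]|x Qx].
  by case: (Qp _ _ Ts Tx Qsx).
have Tx := QT _ Qx; split=> //; split; first exact: TS.
by exists 1; rewrite mul1r; split=> //; [exact: subring1|exact: (prime1 ringT pQ)].
Qed.

Lemma extend_prime : prime_ideal S (extend S Q).
Proof.
have [[[Q0 QA QM] QT] _ Qp] := pQ.
have nQ1 := prime1 ringT pQ.
have idE : ideal S (extend S Q).
  split; last by move=> x [].
  split.
  - split; first exact: subring0.
    by exists 1; rewrite mulr0; split=> //; exact: subring1.
  - move=> x y [Sx [s [Ts nQs Qsx]]] [Sy [t [Tt nQt Qty]]]; split; first exact: subringD.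
    exists (s * t); split; [exact: subringM|exact: (prime_compl pQ)|].
    rewrite mulrDr; apply: QA; last by rewrite -mulrA; exact: QM.
    by rewrite mulrAC mulrC; exact: QM.
  - move=> r x Sr [Sx [s [Ts nQs Qsx]]]; split; first exact: subringM.
    have [t [Tt nQt Ttr]] := SQ Sr; exists (t * s).
    by split; [exact: subringM|exact: (prime_compl pQ)|rewrite mulrACA; exact: QM].
split=> //.
  apply/(idealDP ringS idE) => -[_ [s [Ts nQs]]]; by rewrite mulr1.
move=> a b Sa Sb [_ [s [Ts nQs Qsab]]].
have [t [Tt nQt Tta]] := SQ Sa; have [r [Tr nQr Trb]] := SQ Sb.
have : Q (s * ((t * a) * (r * b))).
  by rewrite mulrACA [s * _]mulrCA; apply: QM => //; exact: subringM.
case/(Qp _ _ Ts (subringM ringT Tta Trb)) => // /(Qp _ _ Tta Trb)[Qta|Qrb].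
  by left; split=> //; exists t.
by right; split=> //; exists r.
Qed.

Lemma loc_extend : loc S (extend S Q) = loc T Q.
Proof. by rewrite (loc_contr ringT bezT ringS TS extend_prime) extend_contr. Qed.

End Extend.

(** The centers of the members of [fam] on [S] are incomparable and their localizations intersect in
    [S], so every maximal ideal of [S] is a center. Conversely, a maximal ideal above a center is a
    center too, and incomparability makes the two equal. *)
Lemma sharp_family_max (fam : set (set F)) :
  fam !=set0 -> (forall P, fam P -> prime_ideal T P) -> pairwise_incomparable fam ->
  sharp_dom (bigloc T fam) ->
  fam = [set Q | exists2 M, max_ideal (bigloc T fam) M & Q = M `&` T].
Proof.
move=> fam0 famP inc; set S := bigloc T fam => shS.
have ringS : subring S := bigloc_subring ringT famP.
have TS : T `<=` S := bigloc_incl ringT famP.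
have bezS := bezout_overring TS bezT.
have Sloc P : fam P -> S `<=` loc T P by move=> fP x; apply.
pose ext := [set N | exists2 P, fam P & N = extend S P].
have extP N : ext N -> prime_ideal S N.
  by move=> [P fP ->]; apply: extend_prime => //; [exact: famP|exact: Sloc].
have contrE P : fam P -> extend S P `&` T = P.
  by move=> fP; apply: extend_contr => //; exact: famP.
have incE : pairwise_incomparable ext.
  move=> _ _ [P fP ->] [Q fQ ->] PQ; congr (extend S _); apply: inc => //.
  by rewrite -(contrE P fP) -(contrE Q fQ) => x [/PQ].
have maxE M : max_ideal S M -> ext M.
  apply: (max_in_family ringS bezS shS) => //.
    by have [P fP] := fam0; exists (extend S P); exists P.
  move=> x xE P fP; have : loc S (extend S P) x by apply: xE; exists P.
  by rewrite loc_extend //; [exact: famP|exact: Sloc].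
apply/seteqP; split=> [P fP|_ [M /maxE[P fP ->] ->]]; last by rewrite contrE.
have pE : prime_ideal S (extend S P) by apply: extP; exists P.
have [idE _ _] := pE.
have [M mM PM] := max_ideal_exists ringS idE (prime1 ringS pE).
exists M => //; have [Q fQ MQ] := maxE M mM.
rewrite MQ contrE //; apply: inc => //.
by rewrite -(contrE P fP) -(contrE Q fQ) -MQ => x [/PM].
Qed.

(** The counterpart in [T] of the t##-condition: nonzero primes replace t-primes, and empty families
    are allowed. *)
Definition prime_sharp := forall P1 P2 : set (set F),
  (forall P, P1 P -> prime_ideal T P /\ P <> [set 0]) ->
  (forall P, P2 P -> prime_ideal T P /\ P <> [set 0]) ->
  pairwise_incomparable P1 -> pairwise_incomparable P2 ->
  P1 <> P2 -> bigloc T P1 <> bigloc T P2.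

(** Forward, each nonempty family is recovered from its intersection as the contractions of the
    maximal ideals. Backward, maximal ideals of an overring contract to incomparable primes of [T]
    with the same localizations. *)
Lemma sharp_sharpP : sharp_sharp_dom T <-> prime_sharp.
Proof.
split=> [shT P1 P2 pP1 pP2 inc1 inc2 nP E|psh S ringS TS M1 M2 [N1 MN1] [N2 MN2] mM1 mM2 nM E].
  have empty P P' : P = set0 -> (forall Q, P' Q -> prime_ideal T Q /\ Q <> [set 0]) ->
      bigloc T P' = bigloc T P -> P' = set0.
    move=> P0 pP' PP'; apply: contrapT => /eqP/set0P[Q P'Q].
    have [pQ Q0] := pP' Q P'Q.
    apply: (bigloc_nonzero_prime P'Q pQ Q0); rewrite PP' P0; apply/seteqP; split=> // x _ ? [].
  have prime P : (forall Q, P Q -> prime_ideal T Q /\ Q <> [set 0]) ->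
    forall Q, P Q -> prime_ideal T Q by move=> pP Q /pP[].
  have [P10|/eqP/set0P ne1] := pselect (P1 = set0).
    by apply: nP; rewrite P10 (empty P1 P2).
  have [P20|/eqP/set0P ne2] := pselect (P2 = set0).
    by apply: nP; rewrite P20 (empty P2 P1).
  have sh P : (forall Q, P Q -> prime_ideal T Q) -> sharp_dom (bigloc T P).
    by move=> pP; apply: shT; [exact: bigloc_subring|exact: bigloc_incl].
  apply: nP; rewrite (sharp_family_max ne1 (prime _ pP1) inc1 (sh _ (prime _ pP1))).
  by rewrite [RHS](sharp_family_max ne2 (prime _ pP2) inc2 (sh _ (prime _ pP2))) E.
have pM M : max_ideal S M -> prime_ideal S M by exact: max_ideal_prime.
(* If [S] is a field, 0 is its only maximal ideal and two nonempty families coincide. The case is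
   separate because [prime_sharp] speaks of nonzero primes. *)
have [z|nz] := pselect (max_ideal S [set 0]).
  have zero M : max_ideal S M -> M = [set 0].
    move=> mM; have [[sub _] _ _] := z; have [idM nMS _] := mM.
    have [_ _] := z; apply=> // x ->; by case: idM => -[].
  apply: nM; apply/seteqP; split=> M MM.
    by rewrite (zero M (mM1 _ MM)) -(zero N2 (mM2 _ MN2)).
  by rewrite (zero M (mM2 _ MM)) -(zero N1 (mM1 _ MN1)).
pose contr (fam : set (set F)) := [set Q | exists2 M, fam M & Q = M `&` T].
have contrP fam : fam `<=` max_ideal S ->
    forall Q, contr fam Q -> prime_ideal T Q /\ Q <> [set 0].
  move=> mfam _ [M fM ->]; have mM := mfam _ fM; split.
    by apply: (contr_prime ringT ringS TS); exact: pM.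
  (* The numerator of a nonzero element of [M] is a nonzero element of its contraction. *)
  move=> MT0; apply: nz; rewrite (_ : [set 0] = M) //.
  apply/seteqP; split; first by move=> x ->; case: mM => -[[]].
  move=> x Mx; apply: contrapT => /= /eqP x0.
  have [a [b [u [v [[Ta Tb Tu Tv] [b0 xab uv]]]]]] := coprime_frac bezT x.
  have aE : a = b * x by rewrite xab mulrC divfK.
  have : (M `&` T) a.
    by split=> //; rewrite aE; case: mM => -[[_ _ Mm] _] _ _; apply: Mm => //; exact: TS.
  by rewrite MT0 /= aE => /eqP; rewrite mulf_eq0 (negPf b0) (negPf x0).
have contr_inc fam : fam `<=` max_ideal S -> pairwise_incomparable (contr fam).
  move=> mfam _ _ [M fM ->] [N fN ->] MN; have mM := mfam _ fM; have mN := mfam _ fN.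
  have MN' : M `<=` N.
    by apply: (contr_sub bezT ringS TS (pM _ mM) (pM _ mN)) => x /MN[].
  by have [_ _ /(_ N)->//] := mM; case: mN.
have contr_loc fam : fam `<=` max_ideal S -> bigloc T (contr fam) = bigloc S fam.
  move=> mfam; apply/seteqP; split=> x xf.
    move=> M fM; rewrite (loc_contr ringT bezT ringS TS (pM _ (mfam _ fM))).
    by apply: xf; exists M.
  move=> _ [M fM ->].
  by rewrite -(loc_contr ringT bezT ringS TS (pM _ (mfam _ fM))); exact: xf.
have contr_subset fam fam' : fam `<=` max_ideal S -> fam' `<=` max_ideal S ->
    contr fam = contr fam' -> fam `<=` fam'.
  move=> mf mf' ff' M fM; have : contr fam (M `&` T) by exists M.
  rewrite ff' => -[N f'N MN].
  by rewrite (contr_inj bezT ringS TS (pM _ (mf _ fM)) (pM _ (mf' _ f'N)) MN).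
apply: (psh (contr M1) (contr M2)); [exact: contrP|exact: contrP|exact: contr_inc|exact: contr_inc| |].
  by move=> c12; apply: nM; apply/seteqP; split; apply: contr_subset.
by rewrite !contr_loc.
Qed.

End SharpSharp.

(** * The t-Nagata ring *)

Local Notation "x %:F" := (FracField.tofrac x).

Lemma fracE (A : idomainType) (x : {fraction A}) :
  exists n d : A, d != 0 /\ x = n%:F / d%:F.
Proof.
elim/quotW: x => x; exists (frac x).1, (frac x).2; split; first exact: denom_ratioP.
unlock FracField.tofrac.
rewrite -[X in _ = _ * X]FracField.pi_inv -[RHS]FracField.pi_mul.
rewrite /FracField.mulf /FracField.invf !numden_Ratio ?oner_neq0 ?denom_ratioP //.
by rewrite mul1r mulr1 Ratio_numden.
Qed.

Section Nagata.
Variable R : idomainType.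
Local Notation K := {fraction R}.
Local Notation L := {fraction {poly R}}.
Local Notation D := (Rimg R).
Local Notation T := (nagata R).
Local Notation "f ^F" := (map_poly (@FracField.tofrac R) f) (at level 2, format "f ^F").

Lemma Rimg_frac (r : R) : D r%:F. Proof. by exists r. Qed.

Lemma Rimg_subring : subring D.
Proof.
split; [by exists 0; rewrite rmorph0|by exists 1; rewrite rmorph1| |].
  by move=> _ _ [r ->] [s ->]; exists (r - s); rewrite rmorphB.
by move=> _ _ [r ->] [s ->]; exists (r * s); rewrite rmorphM.
Qed.

Lemma Rimg_denom (x : K) : exists d, [/\ D d, d != 0 & D (d * x)].
Proof.
have [n [d [d0 ->]]] := fracE x; exists d%:F; rewrite tofrac_eq0 d0.
by split=> //; [exists d|exists n; rewrite mulrC divfK // tofrac_eq0].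
Qed.

(** A numerator and a denominator are picked by choice; [fracC_frac] shows by cross-multiplication
    that the value of [fracC] does not depend on them. *)
Definition fracC_rep (x : K) := cid (fracE x).
Definition fracC (x : K) : L :=
  let: n := projT1 (fracC_rep x) in let: d := projT1 (cid (projT2 (fracC_rep x))) in
  n%:P%:F / d%:P%:F.

Lemma fracC_frac (n d : R) : d != 0 -> fracC (n%:F / d%:F) = n%:P%:F / d%:P%:F.
Proof.
move=> d0; rewrite /fracC; case: fracC_rep => n' /= ex; case: cid => d' /= [d'0 E].
apply/eqP; rewrite eqr_div ?tofrac_eq0 ?polyC_eq0 //.
rewrite -!tofracM -!polyCM tofrac_eq (inj_eq (@polyC_inj _)).
by move/eqP: E; rewrite eqr_div ?tofrac_eq0 // -!tofracM tofrac_eq eq_sym.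
Qed.

Lemma fracC_tofrac (r : R) : fracC r%:F = r%:P%:F.
Proof. by have := fracC_frac r (oner_neq0 R); rewrite polyC1 !tofrac1 !divr1. Qed.

Fact fracC_zmod_morphism : zmod_morphism fracC.
Proof.
move=> x y; have [n [d [d0 ->]]] := fracE x; have [m [e [e0 ->]]] := fracE y.
have F0 (A : idomainType) (a : A) : a != 0 -> a%:F != 0 by rewrite tofrac_eq0.
have P0 (a : R) : a != 0 -> a%:P%:F != 0 by rewrite tofrac_eq0 polyC_eq0.
rewrite -mulNr addf_div ?F0 // -tofracN -!tofracM -tofracD !fracC_frac ?mulf_neq0 //.
rewrite -mulNr addf_div ?P0 // -tofracN -!tofracM -tofracD.
by rewrite polyCD !polyCM polyCN.
Qed.

Fact fracC_monoid_morphism : monoid_morphism fracC.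
Proof.
split; first by rewrite -tofrac1 fracC_tofrac polyC1 tofrac1.
move=> x y; have [n [d [d0 ->]]] := fracE x; have [m [e [e0 ->]]] := fracE y.
rewrite mulf_div -!tofracM !fracC_frac ?mulf_neq0 //.
by rewrite mulf_div -!tofracM !polyCM.
Qed.

HB.instance Definition _ := GRing.isZmodMorphism.Build K L fracC fracC_zmod_morphism.
HB.instance Definition _ := GRing.isMonoidMorphism.Build K L fracC fracC_monoid_morphism.

(* [phi] embeds K[X] into K(X), extending the embedding [fracC] of K. *)
Definition phi (h : {poly K}) : L := (map_poly fracC h).['X%:F].

Lemma phiD h k : phi (h + k) = phi h + phi k.
Proof. by rewrite /phi rmorphD hornerD. Qed.
Lemma phiM h k : phi (h * k) = phi h * phi k.
Proof. by rewrite /phi rmorphM hornerM. Qed.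
Lemma phiC c : phi c%:P = fracC c.
Proof. by rewrite /phi map_polyC hornerC. Qed.
Lemma phiX : phi 'X = 'X%:F.
Proof. by rewrite /phi map_polyX hornerX. Qed.
Lemma phiE h : phi h = \sum_(i < size h) fracC h`_i * 'X%:F ^+ i.
Proof. by rewrite /phi horner_coef size_map_poly; apply: eq_bigr => i _; rewrite coef_map. Qed.

Lemma phi_tofrac f : phi f^F = f%:F.
Proof.
elim/poly_ind: f => [|f c IH]; first by rewrite !rmorph0 /phi rmorph0 horner0.
rewrite rmorphD rmorphM /= map_polyX map_polyC phiD phiM IH phiX phiC.
by rewrite fracC_tofrac -tofracM -tofracD.
Qed.

Lemma Rimg_poly (h : {poly K}) : (forall i, D h`_i) -> exists f, h = f^F.
Proof.
move=> /choice[r hr]; exists (\poly_(i < size h) r i).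
apply/polyP => i; rewrite coef_map coef_poly; case: ltnP => [_|hi]; first exact: hr.
by rewrite nth_default //= tofrac0.
Qed.

Lemma coef_mulR (A : set K) (h : {poly K}) (f : {poly R}) : submodule D A -> (forall i, A h`_i) ->
  forall i, A (h * f^F)`_i.
Proof.
move=> subA hA i; rewrite coefM; apply: (submodule_sum subA) => j.
by rewrite coef_map mulrC; case: subA => _ _; apply => //; exact: Rimg_frac.
Qed.

Lemma vcl_coef (h : {poly K}) i : vcl D h h`_i.
Proof.
case: (ltnP i (size h)) => hi; first by apply: vcl_mem; exact: mem_nth.
by rewrite nth_default // => z _; rewrite mulr0; exact: (subring0 Rimg_subring).
Qed.

Lemma poly_neq0P (h : {poly K}) : h != 0 <-> exists2 y, y \in (h : seq K) & y != 0.
Proof.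
split=> [h0|[y yh]]; last by apply: contraNneq => h0; move: yh; rewrite h0 polyseq0.
exists (lead_coef h); last by rewrite lead_coef_eq0.
by rewrite mem_nth // prednK // size_poly_gt0.
Qed.

(** The content is finitely generated, so having t-closure [D] amounts to having 1 in the v-closure
    of the coefficients. *)
Lemma NtP g : Nt R g <-> g != 0 /\ vcl D g^F 1.
Proof.
have ringD := Rimg_subring.
have cE : content g = Defs.span D g^F.
  rewrite /content; congr (Defs.span D _).
  rewrite map_polyE (@PolyK _ 1%:F) //.
  by rewrite last_map tofrac_eq0; case: g.
have subC : submodule D (content g) by rewrite cE; exact: span_submodule.
have CD : content g `<=` D.
  move=> x; rewrite cE; apply: span_min; first exact: submodule_ring.
  by move=> y /(nthP 0)[i _ <-]; rewrite coef_map; exact: Rimg_frac.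
split=> [Ng|[g0 vg]].
  have : tclos D (content g) 1 by rewrite Ng; exact: (subring1 ringD).
  move=> /(tclosP ringD _ subC)[s [sC [y ys y0] s1]]; split.
    apply: contra_neq y0 => g0; move: (sC y ys).
    by rewrite cE g0 map_poly0 polyseq0 => -[r [_ _ ->]]; rewrite big_ord0.
  move=> z zg; apply: s1 => x /sC; rewrite cE; move: x.
  by apply: span_min => //; apply: submodule_scale; exact: submodule_ring.
rewrite /Nt /=; apply/seteqP; split; first exact: tclos_sub_ring.
move=> r Dr; apply/(tclosP ringD _ subC); exists (g^F : seq K); split.
- by move=> y yg; rewrite cE; exact: mem_span.
- by apply/poly_neq0P; rewrite map_poly_eq0_id0 ?tofrac_eq0 // lead_coef_eq0.
- by move=> z zg; rewrite -[r]mulr1 mulrCA; apply: subringM => //; exact: vg.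
Qed.


Lemma Nt_neq0 g : Nt R g -> g%:F != 0.
Proof. by move=> /NtP[g0 _]; rewrite tofrac_eq0. Qed.

(** Together with [Nt_avoidP]: a nonzero polynomial is in N_t iff it lies in M[X] for no t-maximal
    M. *)
Lemma Nt_avoid g M : Nt R g -> t_max D M -> exists i, ~ M g^F`_i.
Proof.
move=> /NtP[g0 vg] tM; apply: contrapT => /forallNP gM.
apply: (prime1 Rimg_subring (t_max_prime Rimg_subring tM)).
have [[subM _] _ [_ <-] _] := tM.
apply/(tclosP Rimg_subring _ subM); exists (g^F : seq K); split=> //.
- by move=> y /(nthP 0)[i _ <-]; exact: contrapT (gM i).
- by apply/poly_neq0P; rewrite map_poly_eq0_id0 ?tofrac_eq0 // lead_coef_eq0.
Qed.

Lemma Nt_avoidP g : g != 0 -> (forall M, t_max D M -> exists i, ~ M g^F`_i) -> Nt R g.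
Proof.
move=> g0 gM; have ringD := Rimg_subring; apply/NtP; split=> //.
have gF0 : exists2 y, y \in (g^F : seq K) & y != 0.
  by apply/poly_neq0P; rewrite map_poly_eq0_id0 ?tofrac_eq0 // lead_coef_eq0.
pose J := Defs.span D g^F.
have subJ : submodule D J by exact: span_submodule.
have JD : J `<=` D.
  apply: span_min; first exact: submodule_ring.
  by move=> y /(nthP 0)[i _ <-]; rewrite coef_map; exact: Rimg_frac.
have J0 : J <> [set 0] by apply/span_neq0.
apply: contrapT => nv.
have [|M tM JM] := t_max_exists ringD (conj subJ JD) J0.
  move=> /(tclosP ringD _ subJ)[s [sJ _ s1]]; apply: nv => z zg; apply: s1 => x /sJ.
  by move: x; apply: span_min => //; apply: submodule_scale; exact: submodule_ring.
have [i nMi] := gM M tM; apply: nMi; case: (ltnP i (size g^F)) => hi.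
  by apply: JM; apply: mem_span => //; exact: mem_nth.
by rewrite nth_default //; have [[[]]] := tM.
Qed.

(** P[X] is prime: look at the coefficient of index [i + j], where [i] and [j] are the first indices
    at which [f] and [g] leave [P]. *)
Lemma prime_poly (P : set K) (f g : {poly R}) : prime_ideal D P ->
  (exists i, ~ P f^F`_i) -> (exists i, ~ P g^F`_i) -> exists i, ~ P (f * g)^F`_i.
Proof.
move=> [[subP PD] _ Pp] [i0 fi0] [j0 gj0].
have least (h : {poly R}) k : ~ P h^F`_k ->
    exists i, ~ P h^F`_i /\ forall j, (j < i)%N -> P h^F`_j.
  move=> hk; have ex : exists k, `[< ~ P h^F`_k >] by exists k; apply/asboolP.
  case: (ex_minnP ex) => i /asboolP hi imin; exists i; split=> // j ji.
  by apply: contrapT => /asboolP/imin; rewrite leqNgt ji.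
have [i [fi fmin]] := least _ _ fi0; have [j [gj gmin]] := least _ _ gj0.
exists (i + j)%N; rewrite rmorphM coefM.
have lti : (i < (i + j).+1)%N by rewrite ltnS leq_addr.
rewrite (bigD1 (Ordinal lti)) //= addKn => Psum.
have fD k : D f^F`_k by rewrite coef_map; exact: Rimg_frac.
have gD k : D g^F`_k by rewrite coef_map; exact: Rimg_frac.
have [P0 PA PM] := subP.
(* In every other term one factor has index below its minimum, hence lies in [P]. *)
have Prest : P (\sum_(k < (i + j).+1 | k != Ordinal lti) f^F`_k * g^F`_(i + j - k)).
  elim/big_ind: _ => // k; rewrite -val_eqE /= => nki.
  have [ki|ik] := ltnP k i; first by rewrite mulrC; apply: PM => //; exact: fmin.
  apply: PM => //; apply: gmin.
  have ltik : (i < k)%N by rewrite ltn_neqAle eq_sym nki.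
  by rewrite ltn_subLR ?ltn_add2r // -ltnS.
have := submoduleB Rimg_subring subP Psum Prest; rewrite addrK.
by case/Pp.
Qed.

Lemma NtM f g : Nt R f -> Nt R g -> Nt R (f * g).
Proof.
move=> Nf Ng; have [f0 _] := (NtP f).1 Nf; have [g0 _] := (NtP g).1 Ng.
apply: Nt_avoidP => [|M tM]; first exact: mulf_neq0.
by apply: prime_poly; [exact: (t_max_prime Rimg_subring tM)|exact: Nt_avoid|exact: Nt_avoid].
Qed.

Lemma Nt1 : Nt R 1.
Proof.
apply/NtP; split; first exact: oner_neq0.
by rewrite rmorph1; apply: vcl_mem; rewrite polyseq1 mem_head.
Qed.

Lemma nagata_tofrac f : T f%:F.
Proof. by exists f, 1; rewrite tofrac1 divr1; split=> //; exact: Nt1. Qed.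

Lemma nagata_inv g : Nt R g -> T g%:F^-1.
Proof. by exists 1, g; rewrite tofrac1 div1r. Qed.

Lemma nagata_subring : subring T.
Proof.
split.
- by rewrite -(tofrac0 {poly R}); exact: nagata_tofrac.
- by rewrite -(tofrac1 {poly R}); exact: nagata_tofrac.
- move=> _ _ [f [g [Ng ->]]] [f' [g' [Ng' ->]]].
  exists (f * g' - f' * g), (g * g'); split; first exact: NtM.
  by rewrite -mulNr addf_div ?Nt_neq0 // rmorphB !rmorphM /= mulNr.
- move=> _ _ [f [g [Ng ->]]] [f' [g' [Ng' ->]]].
  exists (f * f'), (g * g'); split; first exact: NtM.
  by rewrite mulf_div !rmorphM.
Qed.

(* With [k] at least [size h], the coefficients of [h * \sum_j b_j X^((k+1) j)] are exactly the
   products of those of [h] with the [b_j], so that no content formula is needed. *)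
Lemma spread_poly k (bs : seq K) : exists g : {poly K},
  (forall P : set K, P 0 -> (forall b, b \in bs -> P b) -> forall j, P g`_j) /\
  forall h : {poly K}, (size h <= k)%N -> forall y b, y \in (h : seq K) -> b \in bs ->
    exists i, (h * g)`_i = y * b.
Proof.
elim: bs => [|c bs [g [gP gh]]].
  by exists 0; split=> // P P0 _ j; rewrite coef0.
exists (c%:P + 'X^(k.+1) * g); split.
  move=> P P0 Pb j; rewrite coefD coefC coefXnM ltnS.
  have Pg i : P g`_i by apply: gP => // b bs_b; apply: Pb; rewrite inE bs_b orbT.
  case: leqP => [_|kj].
    by rewrite addr0; case: eqP => // _; apply: Pb; exact: mem_head.
  by rewrite -[j]prednK ?(leq_ltn_trans _ kj) //= add0r.
move=> h hk y b /(nthP 0)[i hi <-]; rewrite inE => /orP[/eqP->|bs_b].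
  by exists i; rewrite mulrDr mulrCA coefD coefMC coefXnM ltnS ltnW ?addr0 // (leq_trans hi hk).
have [l hl] := gh h hk _ b (mem_nth 0 hi) bs_b; exists (l + k.+1)%N.
rewrite mulrDr mulrCA coefD coefMC coefXnM ltnNge leq_addl /= addnK hl.
by rewrite nth_default ?mul0r ?add0r // (leq_trans hk) // addnS ltnW // ltnS leq_addl.
Qed.

End Nagata.

(** * Contraction and extension of submodules *)

Section ContractExtend.
Variable R : idomainType.
Local Notation K := {fraction R}.
Local Notation L := {fraction {poly R}}.
Local Notation D := (Rimg R).
Local Notation T := (nagata R).
Local Notation "f ^F" := (map_poly (@FracField.tofrac R) f) (at level 2, format "f ^F").

Hypotheses (nfield : D <> setT) (pvmd : PvMD D).
Let ringD := @Rimg_subring R.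
Let ringT := @nagata_subring R.

(** [h'] spreads out a list [bs] generating a t-inverse of the content of [h]. The products of
    coefficients of [h] with [bs] all occur as coefficients of [h * h'], so its content has
    v-closure [D]. *)
Lemma poly_inverse (h : {poly K}) : h != 0 ->
  exists h' n, [/\ Nt R n, h * h' = n^F & forall x, vcl D h x -> forall j, D (x * h'`_j)].
Proof.
move=> h0; have /poly_neq0P hn0 := h0.
have [bs [bsD bs1]] := t_invertible ringD (@Rimg_denom R) pvmd hn0.
have [h' [h'P h'c]] := spread_poly (size h) bs.
have h'D x : vcl D h x -> forall j, D (x * h'`_j).
  move=> vx; apply: (h'P [set c | D (x * c)]) => [|b bs_b] /=.
    by rewrite mulr0; exact: subring0.
  by rewrite mulrC; apply: vx => y yh; rewrite mulrC; exact: bsD.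
have [n hn] : exists n, h * h' = n^F.
  apply: Rimg_poly => i; rewrite coefM; apply: (submodule_sum (submodule_ring ringD)) => j.
  exact/h'D/vcl_coef.
exists h', n; split=> //.
have v1 : vcl D n^F 1.
  move=> z zn; rewrite mulr1; apply: bs1 => y b yh bs_b.
  have [i <-] := h'c h (leqnn _) y b yh bs_b; rewrite hn.
  have [hi|hi] := ltnP i (size n^F); first by apply: zn; exact: mem_nth.
  by rewrite nth_default ?mulr0 //; exact: subring0.
(* If [n] were 0, the v-closure of the empty list would contain 1, forcing [D] to be the whole
   field. *)
apply/NtP; split=> //; apply/eqP => n0; apply: nfield; apply/seteqP; split=> // z _.
by rewrite -[z]mulr1; apply: v1 => y; rewrite n0 rmorph0 polyseq0.
Qed.

Lemma phi_eq0 (h : {poly K}) : phi h = 0 -> h = 0.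
Proof.
move=> ph; apply/eqP/negPn/negP => /poly_inverse[h' [n [Nn hn _]]].
by have := Nt_neq0 Nn; rewrite -phi_tofrac -hn phiM ph mul0r eqxx.
Qed.

Lemma phi_inj : injective (@phi R).
Proof.
move=> h k hk; apply/eqP; rewrite -subr_eq0; apply/eqP/phi_eq0.
by rewrite -mulN1r -polyCN phiD phiM phiC rmorphN1 hk mulN1r subrr.
Qed.

(* The coefficients of [h], and more generally the v-closure of the ideal they generate, lie
   in the principal fractional ideal of [T] generated by [h]. *)
Lemma phi_dvd (h : {poly K}) x : h != 0 -> vcl D h x -> exists2 t, T t & fracC x = phi h * t.
Proof.
move=> /poly_inverse[h' [n [Nn hn vD]]] /vD xD.
(* Since [h * h'] is [n], [x] equals [h] times [x h' / n], and [x h'] has coefficients in [D]. *)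
have [f fE] : exists f, x%:P * h' = f^F by apply: Rimg_poly => j; rewrite coefCM.
exists (f%:F / n%:F); first by exists f, n.
apply: (mulIf (Nt_neq0 Nn)); rewrite -[RHS]mulrA divfK ?Nt_neq0 //.
by rewrite -!phi_tofrac -fE -hn !phiM phiC mulrCA.
Qed.

(** A denominator [q] is moved into N_t by multiplying numerator and denominator by [q'] from
    [poly_inverse]. *)
Lemma nagata_rep (x : L) : exists h n, Nt R n /\ x = phi h / n%:F.
Proof.
have [p [q [q0 ->]]] := fracE x.
have /poly_inverse[q' [n [Nn qn _]]] : q^F != 0.
  by rewrite map_poly_eq0_id0 ?tofrac_eq0 // lead_coef_eq0.
exists (p^F * q'), n; split=> //.
have qF0 : q%:F != 0 by rewrite tofrac_eq0.
apply/eqP; rewrite (eqr_div _ _ qF0 (Nt_neq0 Nn)) -!phi_tofrac -qn !phiM.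
by rewrite -mulrA [phi q' * _]mulrC.
Qed.

Lemma fracC_Rimg x : D x -> T (fracC x).
Proof. by move=> [r ->]; rewrite fracC_tofrac; exact: nagata_tofrac. Qed.

Section Submodule.
Variable B : set L.
Hypothesis subB : submodule T B.

(** This is h T = c(h) T: each coefficient is a [T]-multiple of [h] by [phi_dvd], and [h] is a
    combination of its coefficients with powers of X. Hence a [T]-submodule is determined by its
    elements in K. *)
Lemma phi_mem (h : {poly K}) n : Nt R n -> B (phi h / n%:F) <-> forall i, B (fracC h`_i).
Proof.
move=> Nn; have [B0 BA BM] := subB; split=> [Bh i|Bh].
  have [->|h0] := eqVneq h 0; first by rewrite coef0 rmorph0.
  have [t Tt ->] := phi_dvd h0 (@vcl_coef _ h i).
  rewrite mulrC; apply: (BM) => //; rewrite -(divfK (Nt_neq0 Nn) (phi h)) mulrC.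
  by apply: (BM) => //; exact: nagata_tofrac.
rewrite mulrC; apply: (BM); first exact: nagata_inv.
rewrite phiE; apply: (submodule_sum subB) => i; rewrite mulrC; apply: (BM) => //.
by rewrite -rmorphXn; exact: nagata_tofrac.
Qed.

Definition contract : set K := [set x | B (fracC x)].

Lemma contract_submodule : submodule D contract.
Proof.
have [B0 BA BM] := subB; split; rewrite /contract /=.
- by rewrite rmorph0.
- by move=> x y Bx By; rewrite rmorphD; exact: BA.
- by move=> r x Dr Bx; rewrite rmorphM; apply: BM => //; exact: fracC_Rimg.
Qed.

Lemma contract_tclos : tclos D contract `<=` contract.
Proof.
move=> x /(tclosP ringD _ contract_submodule)[s [sB [y ys y0] sx]].
(* The generators become the coefficients of one polynomial, which divides their whole v-closure in
   [T]. *)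
have h0 : Poly s != 0.
  apply: contraNneq y0 => s0; have /(nthP 0)[i _ <-] := ys.
  by rewrite -coef_Poly s0 coef0.
have vx : vcl D (Poly s) x.
  apply: vcl_trans sx => z /(nthP 0)[i _ <-]; rewrite -coef_Poly; exact: vcl_coef.
rewrite /contract /=; have [t Tt ->] := phi_dvd h0 vx; rewrite mulrC.
have [B0 BA BM] := subB; apply: BM => //.
rewrite -[phi _]divr1 -(tofrac1 {poly R}); apply/(phi_mem _ (Nt1 R)) => i.
rewrite coef_Poly; case: (ltnP i (size s)) => hi; first by apply/sB/mem_nth.
by rewrite nth_default // rmorph0.
Qed.

End Submodule.

Lemma contract_mono B B' : submodule T B -> submodule T B' ->
  contract B `<=` contract B' -> B `<=` B'.
Proof.
move=> subB subB' BB' x; have [h [n [Nn ->]]] := nagata_rep x.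
by move=> /(phi_mem subB _ Nn) Bh; apply/(phi_mem subB' _ Nn) => i; exact/BB'/Bh.
Qed.

Lemma contract_inj B B' : submodule T B -> submodule T B' ->
  contract B = contract B' -> B = B'.
Proof. by move=> sB sB' E; apply/seteqP; split; apply: contract_mono; rewrite ?E. Qed.

Lemma phi_div_eq h n x : Nt R n -> fracC x = phi h / n%:F -> forall i, x * n^F`_i = h`_i.
Proof.
move=> Nn E i; have /phi_inj <- : phi (x%:P * n^F) = phi h.
  by rewrite phiM phiC phi_tofrac E divfK // Nt_neq0.
by rewrite coefCM.
Qed.

(** If [x] = [f / g] with [g] in N_t, then [x] multiplies the coefficients of [g] into [D]; as 1 is
    in their v-closure, [x] is in [D]. *)
Lemma contract_nagata : contract T = D.
Proof.
apply/seteqP; split=> [x [f [g [Ng E]]]|x]; last exact: fracC_Rimg.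
have xg i : x * g^F`_i = f^F`_i by apply: phi_div_eq => //; rewrite phi_tofrac.
have [_ v1] := (NtP g).1 Ng; rewrite -[x]mulr1; apply: v1 => y /(nthP 0)[i _ <-].
by rewrite xg coef_map; exact: Rimg_frac.
Qed.

Definition extension (A : set K) : set L :=
  [set x | exists (h : {poly K}) n, [/\ Nt R n, forall i, A h`_i & x = phi h / n%:F]].

Lemma extension_submodule A : submodule D A -> submodule T (extension A).
Proof.
move=> subA; have [A0 AA AM] := subA; split.
- exists 0, 1; split; [exact: Nt1|by move=> i; rewrite coef0|].
  by rewrite -polyC0 phiC rmorph0 mul0r.
- move=> _ _ [h [n [Nn Ah ->]]] [k [m [Nm Ak ->]]].
  exists (h * m^F + k * n^F), (n * m); split; first exact: NtM.
    by move=> i; rewrite coefD; apply: AA; apply: coef_mulR.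
  by rewrite addf_div ?Nt_neq0 // phiD !phiM !phi_tofrac rmorphM.
- move=> _ _ [f [g [Ng ->]]] [h [n [Nn Ah ->]]].
  exists (h * f^F), (g * n); split; [exact: NtM|by apply: coef_mulR|].
  by rewrite mulf_div phiM phi_tofrac [phi h * _]mulrC rmorphM.
Qed.

Lemma extension_incl A : submodule D A -> A `<=` contract (extension A).
Proof.
move=> [A0 _ _] x Ax; exists x%:P, 1; split; [exact: Nt1| |].
  by move=> i; rewrite coefC; case: ifP.
by rewrite tofrac1 divr1 phiC.
Qed.

Lemma extension_mono A A' : A `<=` A' -> extension A `<=` extension A'.
Proof. by move=> AA' x [h [n [Nn Ah ->]]]; exists h, n; split=> // i; exact: AA'. Qed.

(** If [x] = [h / n] with [h] in A[X], then [x] times the coefficients of [n] lies in [A]. Since 1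
    is in their v-closure, [x] is in the t-closure of [A]. *)
Lemma contract_extension A : submodule D A -> A <> [set 0] ->
  contract (extension A) = tclos D A.
Proof.
move=> subA nA0; have subE := extension_submodule subA.
apply/seteqP; split=> x; last first.
  by move=> /(tclos_mono (extension_incl subA)); exact: contract_tclos.
move=> [h [n [Nn Ah /(phi_div_eq Nn) E]]].
have [->|x0] := eqVneq x 0; first by apply: tclos_incl => //; case: subA.
have [n0 v1] := (NtP n).1 Nn.
have nF0 : n^F != 0 by rewrite map_poly_eq0_id0 ?tofrac_eq0 // lead_coef_eq0.
apply/(tclosP ringD _ subA); exists [seq x * c | c <- (n^F : seq K)]; split.
- by move=> _ /mapP[_ /(nthP 0)[i _ <-] ->]; rewrite E.
- have /poly_neq0P[y yn y0] := nF0.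
  by exists (x * y); [exact: map_f|exact: mulf_neq0].
- move=> z zn; rewrite -[x]mulr1 mulrA; apply: v1 => y yn.
  by rewrite -mulrA; apply/zn/map_f.
Qed.

Lemma extension_contract B : submodule T B -> extension (contract B) = B.
Proof.
move=> subB; apply/seteqP; split=> x.
  by move=> [h [n [Nn Bh ->]]]; apply/(phi_mem subB).
have [h [n [Nn ->]]] := nagata_rep x => /(phi_mem subB _ Nn) Bh.
by exists h, n.
Qed.

End ContractExtend.

(** * Transfer between a PvMD and its t-Nagata ring *)

Section Transfer.
Variable R : idomainType.
Local Notation K := {fraction R}.
Local Notation L := {fraction {poly R}}.
Local Notation D := (Rimg R).
Local Notation T := (nagata R).
Local Notation "f ^F" := (map_poly (@FracField.tofrac R) f) (at level 2, format "f ^F").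

Hypotheses (nfield : D <> setT) (pvmd : PvMD D).
Let ringD := @Rimg_subring R.
Let ringT := @nagata_subring R.
Let subT := submodule_ring ringT.

(** Over a common denominator, the numerators [n] and [p] are stacked without overlap in [q]. Every
    coefficient of either is one of [q], so [q] divides both in [T]. *)
Lemma nagata_bezout : bezout_in T.
Proof.
move=> a b; have [n [m [m0 abE]]] : exists n m : {poly R}, m != 0 /\
    exists p, a = n%:F / m%:F /\ b = p%:F / m%:F.
  have [n [d [d0 ->]]] := fracE a; have [p [e [e0 ->]]] := fracE b.
  exists (n * e), (d * e); split; first exact: mulf_neq0.
  exists (p * d); rewrite !tofracM; split; first by rewrite -mulf_div divff ?mulr1 ?tofrac_eq0.
  by rewrite [d%:F * _]mulrC -mulf_div divff ?mulr1 ?tofrac_eq0.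
have [p [aE bE]] := abE.
have [T0 T1] := (subring0 ringT, subring1 ringT).
pose q := n + p * 'X^(size n).
have qc1 i : (i < size n)%N -> q`_i = n`_i.
  by move=> hi; rewrite coefD coefMXn hi addr0.
have qc2 i : q`_(i + size n) = p`_i.
  by rewrite coefD coefMXn ltnNge leq_addl /= addnK nth_default ?add0r // leq_addl.
have [q0|q0] := eqVneq q 0.
  have n0 : n = 0.
    apply/polyP => i; have [hi|hi] := ltnP i (size n); first by rewrite -qc1 // q0.
    by rewrite nth_default ?coef0.
  have p0 : p = 0 by apply/polyP => i; rewrite -qc2 q0 !coef0.
  exists 0, 1, 0, 1, 0; split=> //.
  by rewrite aE bE n0 p0 tofrac0 !mul0r; split=> //; rewrite mulr1 addr0.
have qF0 : q^F != 0 by rewrite map_poly_eq0_id0 ?tofrac_eq0 // lead_coef_eq0.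
have qF0' : q%:F != 0 by rewrite tofrac_eq0.
have div (f : {poly R}) : (forall i, exists j, f`_i = q`_j) -> T (f%:F / q%:F).
  move=> fq; rewrite mulrC -(phi_tofrac f) phiE mulr_sumr; apply: (submodule_sum subT) => i.
  rewrite mulrA; apply: (subringM ringT); last by rewrite -rmorphXn; exact: nagata_tofrac.
  have [j fj] := fq i; rewrite coef_map fj -(coef_map (@FracField.tofrac R) q).
  have [t Tt ->] := phi_dvd nfield pvmd qF0 (@vcl_coef _ q^F j).
  by rewrite phi_tofrac mulKf.
exists (q%:F / m%:F), (n%:F / q%:F), (p%:F / q%:F), 1, ('X^(size n))%:F; split; split=> //.
- apply: div => i; have [hi|hi] := ltnP i (size n); first by exists i; rewrite qc1.
  (* Beyond [size n] the coefficient is 0, matched with the zero coefficient of [q] at index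
     [size q]. *)
  by exists (size q); rewrite !nth_default.
- by apply: div => i; exists (i + size n)%N; rewrite qc2.
- exact: nagata_tofrac.
- by rewrite aE [RHS]mulrC mulrA divfK.
- by rewrite bE [RHS]mulrC mulrA divfK.
- by rewrite mul1r mulrA -mulrDl -tofracM -tofracD ['X^_ * p]mulrC divff.
Qed.

Lemma contract_ideal B : ideal T B -> ideal D (contract B).
Proof.
move=> [subB BT]; split; first exact: contract_submodule.
by rewrite -(contract_nagata nfield pvmd) => x; exact: BT.
Qed.

Lemma contract1 (B : set L) : contract B 1 <-> B 1.
Proof. by rewrite /contract /= rmorph1. Qed.

Lemma contract_set0 : contract (R := R) [set 0] = [set 0].
Proof.
apply/seteqP; split=> x; rewrite /contract /=; last by move=> ->; rewrite rmorph0.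
by move=> /eqP; rewrite fmorph_eq0 => /eqP.
Qed.

Lemma contract_neq0 B : submodule T B -> B <> [set 0] -> contract B <> [set 0].
Proof.
move=> subB B0; rewrite -contract_set0 => /(contract_inj nfield pvmd subB).
by move=> /(_ (submodule_set0 _))/B0.
Qed.

Lemma contract_t_ideal B : ideal T B -> B <> [set 0] -> t_ideal D (contract B).
Proof.
move=> idB B0; have [subB _] := idB; apply: (ideal_t_ideal ringD).
- exact: contract_ideal.
- exact: contract_neq0.
- exact: contract_tclos.
Qed.

Lemma contract_prime Q : prime_ideal T Q -> prime_ideal D (contract Q).
Proof.
move=> pQ; have [idQ _ Qp] := pQ; have idC := contract_ideal idQ; split=> //.
  by apply/(idealDP ringD idC) => /contract1; exact: (prime1 ringT pQ).
by move=> a b Da Db; rewrite /contract /= rmorphM; apply: Qp; exact: fracC_Rimg.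
Qed.

Lemma contract_proper B : ideal T B -> (B <> T <-> contract B <> D).
Proof.
move=> idB; rewrite (idealDP ringT idB) (idealDP ringD (contract_ideal idB)).
by split=> nB1 B1; apply: nB1; apply/contract1.
Qed.

Lemma contract_t_prime Q : prime_ideal T Q -> Q <> [set 0] -> t_prime D (contract Q).
Proof.
by move=> pQ Q0; split; [exact: contract_prime|apply: contract_t_ideal => //; case: pQ].
Qed.

Lemma contract_extension_t A : t_ideal D A -> contract (extension A) = A.
Proof. by move=> [[subA A0 _] tA]; rewrite contract_extension. Qed.

Lemma extension_ideal A : ideal D A -> ideal T (extension A).
Proof.
move=> [subA AD]; split; first exact: extension_submodule.
rewrite -(extension_contract nfield pvmd subT) (contract_nagata nfield pvmd).
exact: extension_mono.
Qed.

Lemma extension_neq0 A : submodule D A -> A <> [set 0] -> extension A <> [set 0].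
Proof.
move=> subA A0 E0; apply: A0; apply/seteqP; split=> x; last by move=> ->; case: subA.
by move=> /(extension_incl subA); rewrite E0 contract_set0.
Qed.

(** Membership of a fraction is read off from the coefficients of its numerator, which reduces the
    claim to primality of P[X]. *)
Lemma extension_prime P : t_prime D P -> prime_ideal T (extension P).
Proof.
move=> [pP tP]; have [idP nPD Pp] := pP; have idE := extension_ideal idP.
have [subE _] := idE; have EP := contract_extension_t tP.
split=> //; first by apply/(contract_proper idE); rewrite EP.
move=> _ _ [f [g [Ng ->]]] [f' [g' [Ng' ->]]]; rewrite mulf_div -!tofracM.
rewrite -[(f * f')%:F]phi_tofrac => /(phi_mem nfield pvmd subE _ (NtM Ng Ng')) ff'.
have {}ff' i : P (f * f')^F`_i by rewrite -EP; exact: ff'.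
apply: contrapT => /not_orP[nf nf'].
have coef (h : {poly R}) n : Nt R n -> ~ extension P (h%:F / n%:F) -> exists i, ~ P h^F`_i.
  move=> Nn; apply: contra_notP => /forallNP Ph; rewrite -phi_tofrac.
  by exists h^F, n; split=> // i; exact: contrapT (Ph i).
by have [i] := prime_poly pP (coef _ _ Ng nf) (coef _ _ Ng' nf'); apply.
Qed.

Lemma contract_max M : max_ideal T M -> t_max D (contract M).
Proof.
move=> [idM nMT Mmax]; have [subM MT] := idM.
have M0 : M <> [set 0].
  (* If 0 were maximal, [T] would be a field, and then so would [D], which is its contraction. *)
  move=> M0; apply: nfield; apply/seteqP; split=> // x _.
  have [->|x0] := eqVneq x 0; first exact: (subring0 ringD).
  have [d [Dd d0 Ddx]] := Rimg_denom x.
  have DV : D d^-1.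
    rewrite -(contract_nagata nfield pvmd) /contract /= fmorphV.
    apply: (max_ideal0_inv ringT); first by rewrite -M0.
      exact: fracC_Rimg.
    by rewrite fmorph_eq0.
  by rewrite -[x](mulKf d0); exact: subringM.
split.
- exact: contract_ideal.
- exact/contract_proper.
- exact: contract_t_ideal.
- move=> N idN nND tN MN; have [subN _] := idN.
  have idE := extension_ideal idN; have EN := contract_extension_t tN.
  rewrite -EN (Mmax (extension N)) //; first by apply/(contract_proper idE); rewrite EN.
  by rewrite -(extension_contract nfield pvmd subM); exact: extension_mono.
Qed.

Lemma extension_max M : t_max D M -> max_ideal T (extension M).
Proof.
move=> [idM nMD tM Mmax]; have idE := extension_ideal idM; have [subM _] := idM.
have EM := contract_extension_t tM.
split=> //; first by apply/(contract_proper idE); rewrite EM.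
move=> N idN nNT MN; have [subN _] := idN.
have MN' : M `<=` contract N by rewrite -EM => x; exact: MN.
have N0 : N <> [set 0].
  move=> N0; have [_ M0 _] := tM.1; apply: M0; apply/seteqP; split=> x.
    by move=> /MN'; rewrite N0 contract_set0.
  by move=> ->; case: subM.
rewrite -(Mmax (contract N)) ?extension_contract //; first exact: contract_ideal.
- exact/contract_proper.
- exact: contract_t_ideal.
Qed.

(** For the nontrivial inclusion, a denominator [f / g] outside [Q] has a coefficient of [f] outside
    [Q]. That coefficient is a denominator of [x] over [D], by [phi_mem] applied to [T]. *)
Lemma contract_loc Q : prime_ideal T Q -> contract (loc T Q) = loc D (contract Q).
Proof.
move=> pQ; have [[subQ QT] _ _] := pQ; apply/seteqP; split=> x; last first.
  move=> [s [Ds nQs Dsx]]; exists (fracC s); rewrite -rmorphM.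
  by split=> //; exact: fracC_Rimg.
move=> [_ [[f [g [Ng ->]]] nQ Tfx]].
have [i nfi] : exists i, ~ Q (fracC f^F`_i).
  apply: contrapT => /forallNP Qf; apply: nQ; rewrite -phi_tofrac.
  by apply/(phi_mem nfield pvmd subQ) => // i; exact: contrapT (Qf i).
have fiD : D f^F`_i by rewrite coef_map; exact: Rimg_frac.
exists f^F`_i; split=> //; rewrite -(contract_nagata nfield pvmd) /contract /= rmorphM.
have : T (phi (x%:P * f^F) / g%:F) by rewrite phiM phiC phi_tofrac -mulrA mulrC.
by move=> /(phi_mem nfield pvmd subT _ Ng)/(_ i); rewrite coefCM mulrC rmorphM.
Qed.


(** * Families of primes and their intersections of localizations *)

Section Families.

Definition contract_family (fam : set (set L)) : set (set K) :=
  [set P | exists2 Q, fam Q & P = contract Q].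

Definition extension_family (fam : set (set K)) : set (set L) :=
  [set Q | exists2 P, fam P & Q = extension P].

Lemma contract_extension_family fam : fam `<=` t_prime D ->
  contract_family (extension_family fam) = fam.
Proof.
move=> tfam; have E P : fam P -> contract (extension P) = P.
  by move=> fP; apply: contract_extension_t; case: (tfam _ fP).
apply/seteqP; split=> [_ [_ [P fP ->] ->]|P fP]; first by rewrite E.
by exists (extension P); [exists P|rewrite E].
Qed.

Lemma extension_contract_family fam : fam `<=` prime_ideal T ->
  extension_family (contract_family fam) = fam.
Proof.
move=> pfam; have E Q : fam Q -> extension (contract Q) = Q.
  by move=> fQ; apply: extension_contract => //; have [[]] := pfam _ fQ.
apply/seteqP; split=> [_ [_ [P fP ->] ->]|P fP]; first by rewrite E.
by exists (contract P); [exists P|rewrite E].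
Qed.

Lemma contract_bigloc fam : fam `<=` prime_ideal T ->
  contract (bigloc T fam) = bigloc D (contract_family fam).
Proof.
move=> pfam; apply/seteqP; split=> x xl.
  move=> _ [Q fQ ->]; rewrite -contract_loc; [exact: xl|exact: pfam].
move=> Q fQ; have : loc D (contract Q) x by apply: xl; exists Q.
by rewrite -contract_loc //; exact: pfam.
Qed.

Lemma bigloc_submodule fam : fam `<=` prime_ideal T -> submodule T (bigloc T fam).
Proof.
move=> pfam; have ringB := bigloc_subring ringT pfam; have TB := bigloc_incl ringT pfam.
split; [exact: (subring0 ringB)|exact: (subringD ringB)|].
by move=> r x /TB; exact: (subringM ringB).
Qed.

Lemma bigloc_contract_family fam fam' : fam `<=` prime_ideal T -> fam' `<=` prime_ideal T ->
  bigloc D (contract_family fam) = bigloc D (contract_family fam') <->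
  bigloc T fam = bigloc T fam'.
Proof.
move=> pf pf'; split=> [|E]; rewrite -!contract_bigloc // ?E //.
by apply: contract_inj => //; exact: bigloc_submodule.
Qed.

Lemma contract_family_inj fam fam' : fam `<=` prime_ideal T -> fam' `<=` prime_ideal T ->
  contract_family fam = contract_family fam' -> fam = fam'.
Proof.
by move=> pf pf' E; rewrite -(extension_contract_family pf) E extension_contract_family.
Qed.

Lemma contract_family_incomparable fam : fam `<=` prime_ideal T ->
  pairwise_incomparable (contract_family fam) <-> pairwise_incomparable fam.
Proof.
move=> pfam.
have sub Q : fam Q -> submodule T Q by move=> fQ; have [[]] := pfam _ fQ.
split=> inc P Q => [fP fQ PQ|[P' fP ->] [Q' fQ ->] PQ].
  apply: (contract_inj nfield pvmd (sub _ fP) (sub _ fQ)); apply: inc.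
  - by exists P.
  - by exists Q.
  - by move=> x; exact: PQ.
congr contract; apply: inc => //.
exact: (contract_mono nfield pvmd (sub _ fP) (sub _ fQ)).
Qed.

End Families.

(** * Transfer of the t#- and t##-properties *)

Lemma t_max_t_prime M : t_max D M -> t_prime D M.
Proof. by move=> tM; split; [exact: t_max_prime|case: tM]. Qed.

Lemma t_sharpP : t_sharp_dom D <-> sharp_dom T.
Proof.
split=> [tsh M1 M2 _ _ mM1 mM2 nM|sh M1 M2 tM1 tM2 nM].
  have maxT fam : fam `<=` max_ideal T -> contract_family fam `<=` t_max D.
    by move=> mf _ [Q /mf mQ ->]; exact: contract_max.
  have primeT fam : fam `<=` max_ideal T -> fam `<=` prime_ideal T.
    by move=> mf Q /mf; exact: max_ideal_prime.
  move=> E; apply: (tsh _ _ (maxT _ mM1) (maxT _ mM2)).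
    by move=> /contract_family_inj E'; apply: nM; apply: E'; exact: primeT.
  by apply/bigloc_contract_family => //; exact: primeT.
(* The t#-condition admits empty families, unlike the #-condition, so they are settled first. *)
have empty M M' : M = set0 -> M' `<=` t_max D -> bigloc D M' = bigloc D M -> M' = set0.
  move=> M0 tM' E; apply: contrapT => /eqP/set0P[P M'P].
  have tP := tM' _ M'P; have [_ _ [[_ P0 _] _] _] := tP.
  apply: (bigloc_nonzero_prime M'P (t_max_prime ringD tP) P0).
  by rewrite E M0; apply/seteqP; split=> // x _ ? [].
move=> E.
have [M10|/eqP/set0P[N1 N1M]] := pselect (M1 = set0).
  by apply: nM; rewrite M10 (empty M1 M2).
have [M20|/eqP/set0P[N2 N2M]] := pselect (M2 = set0).
  by apply: nM; rewrite M20 (empty M2 M1).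
have maxE fam : fam `<=` t_max D -> extension_family fam `<=` max_ideal T.
  by move=> tf _ [Q /tf mQ ->]; exact: extension_max.
have primeE fam : fam `<=` t_max D -> extension_family fam `<=` prime_ideal T.
  by move=> tf Q /(maxE _ tf); exact: max_ideal_prime.
have CE fam : fam `<=` t_max D -> contract_family (extension_family fam) = fam.
  by move=> tf; apply: contract_extension_family => M /tf; exact: t_max_t_prime.
apply: (sh (extension_family M1) (extension_family M2)).
- by exists (extension N1); exists N1.
- by exists (extension N2); exists N2.
- exact: maxE.
- exact: maxE.
- by move=> E'; apply: nM; rewrite -(CE M1) // E' CE.
- by apply/bigloc_contract_family; [exact: primeE|exact: primeE|rewrite !CE].
Qed.

Lemma t_sharp_sharpP : t_sharp_sharp_dom D <-> sharp_sharp_dom T.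
Proof.
rewrite (sharp_sharpP ringT nagata_bezout).
split=> [tsh P1 P2 pP1 pP2 inc1 inc2 nP E|sh P1 P2 tP1 tP2 inc1 inc2 nP E].
  have primeT P : (forall Q, P Q -> prime_ideal T Q /\ Q <> [set 0]) -> P `<=` prime_ideal T.
    by move=> pP Q /pP[].
  have t_primeT P : (forall Q, P Q -> prime_ideal T Q /\ Q <> [set 0]) ->
      contract_family P `<=` t_prime D.
    by move=> pP _ [Q /pP[pQ Q0] ->]; exact: contract_t_prime.
  apply: (tsh _ _ (t_primeT _ pP1) (t_primeT _ pP2)).
  - by apply/contract_family_incomparable => //; exact: primeT.
  - by apply/contract_family_incomparable => //; exact: primeT.
  - by move=> /contract_family_inj E'; apply: nP; apply: E'; exact: primeT.
  - by apply/bigloc_contract_family => //; exact: primeT.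
have nzE P : P `<=` t_prime D ->
    forall Q, extension_family P Q -> prime_ideal T Q /\ Q <> [set 0].
  move=> tP _ [Q PQ ->]; have tQ := tP _ PQ; split; first exact: extension_prime.
  by have [_ [[subQ Q0 _] _]] := tQ; exact: extension_neq0.
have primeE P : P `<=` t_prime D -> extension_family P `<=` prime_ideal T.
  by move=> tP Q /(nzE _ tP)[].
have CE := contract_extension_family.
apply: (sh _ _ (nzE _ tP1) (nzE _ tP2)).
- by apply/contract_family_incomparable; [exact: primeE|rewrite CE].
- by apply/contract_family_incomparable; [exact: primeE|rewrite CE].
- by move=> E'; apply: nP; rewrite -(CE P1) // E' CE.
- by apply/bigloc_contract_family; [exact: primeE|exact: primeE|rewrite !CE].
Qed.

(** * Trace ideals, radical ideals and the RTP property *)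

(** By [phi_mem] for the colon module, each coefficient of the numerator of [c] multiplies [I] into
    [T], hence into its contraction [D]. *)
Lemma colon_extension I c : submodule D I -> colon T (extension I) c ->
  extension (colon D I) c.
Proof.
move=> subI; have [h [n [Nn ->]]] := nagata_rep nfield pvmd c.
have subC := submodule_colon (extension I) subT.
move=> /(phi_mem nfield pvmd subC _ Nn) Ch; exists h, n; split=> // i b Ib.
rewrite -(contract_nagata nfield pvmd) /contract /= rmorphM.
by apply: Ch; exact: extension_incl.
Qed.

Lemma contract_trace I : ideal D I -> I <> [set 0] ->
  contract (prodm (extension I) (colon T (extension I))) = tclos D (prodm I (colon D I)).
Proof.
move=> idI I0; have [subI ID] := idI; have subE := extension_submodule subI.
have subP := prodm_submodule (colon D I) subI.
have subPE := prodm_submodule (colon T (extension I)) subE.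
have colonE x : colon D I x -> colon T (extension I) (fracC x).
  move=> Ix _ [h [n [Nn Ih ->]]]; rewrite mulrA -phiC -phiM.
  apply/(phi_mem nfield pvmd subT _ Nn) => i; rewrite coefCM.
  by apply: fracC_Rimg; exact: Ix.
apply/seteqP; split; last first.
  apply: subset_trans (contract_tclos nfield pvmd subPE); apply: tclos_mono.
  apply: (prodm_min (contract_submodule subPE)) => a b Ia Cb.
  rewrite /contract /= rmorphM; apply: prodm_mem; [exact: extension_incl|exact: colonE].
(* As [I] lies in [D], 1 is in [colon D I], so the trace contains [I]. *)
have P0 : prodm I (colon D I) <> [set 0].
  have [y Iy y0] := submodule_neq0 subI I0 => P0.
  have : prodm I (colon D I) (y * 1).
    by apply: prodm_mem => // b Ib; rewrite mul1r; exact: ID.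
  by rewrite P0 mulr1 /= => /eqP; rewrite (negPf y0).
rewrite -(contract_extension nfield pvmd subP P0) => x; rewrite /contract /=.
move: (fracC x); apply: (prodm_min (extension_submodule subP)).
move=> _ c [h [n [Nn Ih ->]]] /(colon_extension subI)[k [m [Nm Ck ->]]].
exists (h * k), (n * m); split; first exact: NtM.
  move=> i; rewrite coefM; apply: (submodule_sum subP) => j.
  by apply: prodm_mem.
by rewrite mulf_div phiM rmorphM.
Qed.

(** If a power of [f / g] is in [B], so is that power of [f]. Each coefficient of [f] is a
    [T]-multiple of [f], so the same power of it is in [B]; radicality below puts the coefficients,
    hence [f / g], in [B]. *)
Lemma contract_radical B : ideal T B -> radical_ideal D (contract B) <-> radical_ideal T B.
Proof.
move=> idB; have [subB BT] := idB; have [_ _ BM] := subB.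
split=> [[_ rad]|[_ rad]]; split=> //; last first.
- move=> x n Dx; rewrite /contract /= rmorphXn; apply: rad; exact: fracC_Rimg.
- exact: contract_ideal.
move=> _ k [f [g [Ng ->]]] Bx; rewrite -phi_tofrac.
apply/(phi_mem nfield pvmd subB _ Ng) => i.
have [f0|f0] := eqVneq f^F 0; first by rewrite f0 coef0 rmorph0; case: subB.
apply: (rad _ k); first by rewrite coef_map; exact: Rimg_frac.
have [t Tt E] := phi_dvd nfield pvmd f0 (@vcl_coef _ f^F i).
have TX s : T s -> T (s ^+ k).
  move=> Ts; elim: k {Bx} => [|k IH]; first by rewrite expr0; exact: (subring1 ringT).
  by rewrite exprS; exact: (subringM ringT).
have Bf : B (f%:F ^+ k).
  rewrite -[f%:F](divfK (Nt_neq0 Ng)) exprMn mulrC; apply: BM => //.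
  exact/TX/nagata_tofrac.
rewrite /contract /= rmorphXn /= E phi_tofrac exprMn mulrC.
by apply: BM => //; exact: TX.
Qed.

Lemma trace_ideal B : ideal T B -> ideal T (prodm B (colon T B)).
Proof.
move=> [subB BT]; split; first exact: prodm_submodule.
by apply: (prodm_min subT) => a b Ba Cb; rewrite mulrC; exact: Cb.
Qed.

(** Every nonzero ideal of [T] is the extension of its contraction, so it suffices to compare the
    two conditions for [I] and [extension I]. *)
Lemma tRTP_P : tRTP_dom D <-> RTP_dom T.
Proof.
have main I : ideal D I -> I <> [set 0] ->
    (tclos D (prodm I (colon D I)) = D \/ radical_ideal D (tclos D (prodm I (colon D I)))) <->
    (prodm (extension I) (colon T (extension I)) = T \/
     radical_ideal T (prodm (extension I) (colon T (extension I)))).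
  move=> idI I0; rewrite -contract_trace //.
  have idE := trace_ideal (extension_ideal idI); rewrite (contract_radical idE).
  suff -> : contract (prodm (extension I) (colon T (extension I))) = D <->
    prodm (extension I) (colon T (extension I)) = T by [].
  rewrite -[X in _ = X <-> _](contract_nagata nfield pvmd).
  by split=> [/contract_inj|->] //; apply=> //; case: idE.
split=> [trtp B idB B0|rtp I idI I0]; last first.
  apply/main => //; apply: rtp; first exact: extension_ideal.
  by case: idI => subI _; exact: extension_neq0.
have [subB _] := idB.
rewrite -(extension_contract nfield pvmd subB).
have idC := contract_ideal idB; have C0 := contract_neq0 subB B0.
by apply/main => //; exact: trtp.
Qed.

End Transfer.

Theorem theorem1p18 (R : idomainType) :
  Rimg R <> setT -> PvMD (Rimg R) ->
  (t_sharp_dom (Rimg R) <-> sharp_dom (nagata R)) /\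
  (t_sharp_sharp_dom (Rimg R) <-> sharp_sharp_dom (nagata R)) /\
  (tRTP_dom (Rimg R) <-> RTP_dom (nagata R)).
Proof.
move=> nfield pvmd; split; first exact: t_sharpP.
by split; [exact: t_sharp_sharpP|exact: tRTP_P].
Qed.
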